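(* Let $n\ge 1$ and $w\in\mathfrak{S}_n$, and let $w^r=w_n\dots w_1$ denote the reverse of $w=w_1\dots w_n$. Then $Q(w)=Q(w^r)$ if and only if $Q(w)$ satisfies both of the following properties: (i) $Q(w)$ has a symmetric hook shape; (ii) for every $i\in[n]$ with $i>1$, if $i$ lies in the first row of $Q(w)$, then $n-i+2$ lies in the first column of $Q(w)$. In particular, $$|\{w\in\mathfrak{S}_n : Q(w)=Q(w^r)\}| = \begin{cases} 2^{\frac{n-1}{2}}\binom{n-1}{\frac{n-1}{2}} & n \text{ odd},\\ 0 & n\text{ even}.\end{cases}$$
   Context: Permutations are written in one-line notation $w=w_1\dots w_n$. $Q(w)$ denotes the recording tableau of $w$ under the Robinson–Schensted(–Knuth) correspondence using Schensted row insertion: $P(w)$ is obtained by successively row-inserting $w_1,\dots,w_n$ into the empty tableau, and $Q(w)$ is the standard Young tableau of the same shape whose cell containing $k$ is the cell created at the $k$-th insertion. A shape is symmetric if it equals its transpose; a hook shape is one of the form $(k,1^{n-k})$. Thus a symmetric hook shape of size $n$ is $((n+1)/2,1^{(n-1)/2})$ with $n$ odd (for $n=1$ this is a single box). *)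

(* Defs.v *)
From mathcomp Require Import all_boot all_fingroup.

Set Implicit Arguments.
Unset Strict Implicit.
Unset Printing Implicit Defensive.

(* A tableau is the sequence of its rows, top row first (English convention). *)
Definition tableau := seq (seq nat).

(* One-line notation, shifted so that the letters are 1, ..., n. *)
Definition one_line (n : nat) (w : 'S_n) : seq nat :=
  [seq (w i).+1 | i <- enum 'I_n].

(* In perm.v, (s * t) i = t (s i), so this is i |-> w (n - 1 - i). *)
Definition rev_perm (n : nat) (w : 'S_n) : 'S_n :=
  (perm (@rev_ord_inj n) * w)%g.

Lemma one_line_rev_perm (n : nat) (w : 'S_n) :
  one_line (rev_perm w) = rev (one_line w).
Proof.
case: n w => [|n] w.
  by rewrite /one_line; case: (enum _) (size_enum_ord 0).
have nthE (v : 'S_n.+1) j : j < n.+1 -> nth 0 (one_line v) j = (v (inord j)).+1.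
  move=> lt_jn; rewrite (nth_map ord0 0 (fun i => (v i).+1)) ?size_enum_ord //.
  congr (nat_of_ord (v _)).+1; apply: val_inj.
  by rewrite /= nth_enum_ord // inordK.
have sizeE (v : 'S_n.+1) : size (one_line v) = n.+1.
  by rewrite size_map size_enum_ord.
apply: (@eq_from_nth _ 0) => [|i]; first by rewrite size_rev !sizeE.
rewrite sizeE => lt_in; have lt_nin : n - i < n.+1 by rewrite ltnS leq_subr.
rewrite nth_rev sizeE // subSS !nthE // permM permE.
congr (nat_of_ord (w _)).+1; apply: val_inj.
by rewrite /= !inordK // subSS.
Qed.

(* Row insertion of x: x replaces the leftmost entry larger than x, which is  *)
(* returned as the bumped entry; if there is none, x is appended.             *)
Fixpoint row_insert (x : nat) (r : seq nat) : option nat * seq nat :=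
  if r is y :: r' then
    if x < y then (Some y, x :: r')
    else let: (b, r'') := row_insert x r' in (b, y :: r'')
  else (None, [:: x]).

(* The second component is the index of the row in which the new cell is      *)
(* created; the new cell is the last cell of that row.                        *)
Fixpoint tab_insert (x : nat) (t : tableau) : tableau * nat :=
  if t is r :: t' then
    match row_insert x r with
    | (None, r') => (r' :: t', 0)
    | (Some y, r') => let: (t'', k) := tab_insert y t' in (r' :: t'', k.+1)
    end
  else ([:: [:: x]], 0).

Definition add_cell (t : tableau) (i k : nat) : tableau :=
  set_nth [::] t i (rcons (nth [::] t i) k).

Definition RS_step (PQ : tableau * tableau) (kx : nat * nat) :
    tableau * tableau :=
  let: (P, i) := tab_insert kx.2 PQ.1 in (P, add_cell PQ.2 i kx.1).

Definition RS (s : seq nat) : tableau * tableau :=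
  foldl RS_step ([::], [::]) (zip (iota 1 (size s)) s).

Definition Qtab (n : nat) (w : 'S_n) : tableau := (RS (one_line w)).2.

Definition transpose_shape (sh : seq nat) : seq nat :=
  [seq count (fun r => j < r) sh | j <- iota 0 (head 0 sh)].

Definition symmetric_shape (sh : seq nat) : Prop := transpose_shape sh = sh.

Definition hook_shape (sh : seq nat) : Prop :=
  exists2 k, 1 <= k <= sumn sh & sh = k :: nseq (sumn sh - k) 1.

Definition first_row (t : tableau) : seq nat := head [::] t.

Definition first_column (t : tableau) : seq nat := pmap ohead t.

(* Main.v *)
Require Import Defs.
From mathcomp Require Import all_boot all_fingroup.
From mathcomp Require Import zify.
From Stdlib Require Import FunctionalExtensionality.

(**
Encode Q(w) by the sequence of row indices of its successive cells.  Removing the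
largest letter changes these indices by a simple automaton, which is Fomin's
local rule relating the shapes of w with its last letter, its largest letter, or
both removed.  Consistency of the local rules around a cube yields by induction
the rules for the pairs (first, largest) and (first, last).  The former shows
that reversal transposes the shape; the latter, that Q(w) determines Q(w_2...w_n).

If Q(w) = Q(w^r), then the word v obtained from w by deleting both ends has the
same property, and the two cells leading from the shape of v to that of w are
transposed to each other.  The (first, last) rule then prevents the diagonal of
the shape from growing, so the shape is a symmetric hook.  For hooks, Q(w) is
determined by the descent set of w, and reversal reverses and complements it.

For the enumeration, removing the largest letter of a word with hook tableau
gives the Pascal recursion for the number of words with a given such tableau.
*)

Set Implicit Arguments.
Unset Strict Implicit.
Unset Printing Implicit Defensive.

(** * Row indices of the successive new cells *)

(** For the empty tableau this word carries the same information as the recording tableau (see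
    [rec_tab_inj]), but it can be edited letter by letter. *)
Fixpoint rows_from (T : tableau) (s : seq nat) : seq nat :=
  if s is x :: s' then
    (tab_insert x T).2 :: rows_from (tab_insert x T).1 s'
  else [::].

Definition rows : seq nat -> seq nat := rows_from [::].

Definition tab_from (T : tableau) (s : seq nat) : tableau :=
  foldl (fun T x => (tab_insert x T).1) T s.

Lemma size_rows_from T s : size (rows_from T s) = size s.
Proof. by elim: s T => //= x s IHs T; rewrite IHs. Qed.

Lemma size_rows s : size (rows s) = size s.
Proof. exact: size_rows_from. Qed.

Lemma rows_from_cat T s1 s2 :
  rows_from T (s1 ++ s2) = rows_from T s1 ++ rows_from (tab_from T s1) s2.
Proof. by elim: s1 T => //= x s1 IHs T; rewrite IHs. Qed.

Lemma rows_cat s1 s2 : exists2 tau, rows (s1 ++ s2) = rows s1 ++ tau & size tau = size s2.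
Proof.
exists (rows_from (tab_from [::] s1) s2); last exact: size_rows_from.
exact: rows_from_cat.
Qed.

Lemma rows_rcons s x : exists i, rows (rcons s x) = rcons (rows s) i.
Proof.
by have [[|i []] // E _] := rows_cat s [:: x]; exists i; rewrite -!cats1.
Qed.

Lemma rows_cat_inj s1 s1' s2 s2' :
  size s1 = size s1' -> rows (s1 ++ s2) = rows (s1' ++ s2') -> rows s1 = rows s1'.
Proof.
move=> es; have [t -> _] := rows_cat s1 s2; have [t' -> _] := rows_cat s1' s2'.
by move/eqP; rewrite eqseq_cat ?size_rows // => /andP[/eqP].
Qed.

(** * Insertion in the presence of a maximal letter *)

Definition entries_below (M : nat) (T : tableau) := all (all (fun z => z < M)) T.

Lemma row_insert_below M x r : x < M -> all (fun z => z < M) r ->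
  all (fun z => z < M) (row_insert x r).2 /\
  (if (row_insert x r).1 is Some y then y < M else true).
Proof.
move=> ltxM; elim: r => [|y r IHr] /=; first by rewrite ltxM.
case/andP=> ltyM alr; case: ifP => _ /=; first by rewrite ltxM.
by case: (row_insert x r) (IHr alr) => b r' /= [-> ?]; rewrite ltyM.
Qed.

Lemma row_insert_max M r : all (fun z => z < M) r ->
  row_insert M r = (None, rcons r M).
Proof. by elim: r => //= y r IHr /andP[ltyM /IHr->]; rewrite ltnNge ltnW. Qed.

Lemma row_insert_rcons M x r : x < M ->
  row_insert x (rcons r M) =
    if row_insert x r is (Some y, r') then (Some y, rcons r' M)
    else (Some M, (row_insert x r).2).
Proof.
move=> ltxM; elim: r => [|y r IHr] /=; first by rewrite ltxM.
case: ifP => // _; rewrite IHr.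
by case: (row_insert x r) => [[z|] r'].
Qed.

Lemma tab_insert_below M x T : x < M -> entries_below M T ->
  entries_below M (tab_insert x T).1.
Proof.
elim: T x => [|r T IHT] x ltxM /=; first by rewrite ltxM.
case/andP=> alr alT; have := row_insert_below ltxM alr.
case: (row_insert x r) => [[z|] r'] /= [alr' ltz]; last by rewrite alr' alT.
have := IHT z ltz alT; case: (tab_insert z T) => T' k /= alT'.
by rewrite alr' alT'.
Qed.

Lemma tab_insert_size x T :
  (tab_insert x T).2 <= size T /\
  size (tab_insert x T).1 = maxn (size T) (tab_insert x T).2.+1.
Proof.
elim: T x => //= r T IHT x; case: (row_insert x r) => [[z|] r'] /=; last lia.
by have := IHT z; case: (tab_insert z T) => T' k /=; lia.
Qed.

Lemma tab_insert_max M T : entries_below M T ->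
  tab_insert M T = (add_cell T 0 M, 0).
Proof. by case: T => //= r T /andP[alr _]; rewrite row_insert_max. Qed.

(* [M] occupies the end of row [k]; it is displaced to row [k + 1] exactly when
   the new cell of the insertion without [M] would be created in row [k]. *)
Lemma tab_insert_add_cell M x T k :
    x < M -> entries_below M T -> k <= size T ->
  tab_insert x (add_cell T k M) =
    let: (T', i) := tab_insert x T in
    if i == k then (add_cell T' k.+1 M, k.+1) else (add_cell T' k M, i).
Proof.
elim: T x k => [|r T IHT] x k ltxM /=.
  by rewrite leqn0 => _ /eqP->; rewrite /add_cell /= ltxM.
case/andP=> alr alT; case: k => [_|k ltk].
  rewrite /add_cell /= row_insert_rcons //.
  have [] := row_insert_below ltxM alr.
  case: (row_insert x r) => [[z|] r'] /= _ ltz.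
    by case: (tab_insert z T).
  by rewrite tab_insert_max.
rewrite /add_cell /=; have [] := row_insert_below ltxM alr.
case: (row_insert x r) => [[z|] r'] //= _ ltz.
have := IHT z k ltz alT ltk; rewrite /add_cell => ->.
by case: (tab_insert z T) => T' i; rewrite eqSS; case: (i == k).
Qed.

(* The effect of a maximal letter, sitting in row [k], on the subsequent row
   indices; [push_end] is the row where it ends up. *)
Fixpoint push (k : nat) (tau : seq nat) : seq nat :=
  if tau is i :: tau' then
    if i == k then k.+1 :: push k.+1 tau' else i :: push k tau'
  else [::].

Fixpoint push_end (k : nat) (tau : seq nat) : nat :=
  if tau is i :: tau' then push_end (if i == k then k.+1 else k) tau' else k.

Lemma push_cat k t1 t2 : push k (t1 ++ t2) = push k t1 ++ push (push_end k t1) t2.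
Proof. by elim: t1 k => //= i t1 IH k; case: ifP; rewrite IH. Qed.

Lemma push_end_cat k t1 t2 : push_end k (t1 ++ t2) = push_end (push_end k t1) t2.
Proof. by elim: t1 k => //= i t1 IH k; case: ifP; rewrite IH. Qed.

Lemma rows_from_add_cell M T k s :
    all (fun z => z < M) s -> entries_below M T -> k <= size T ->
  rows_from (add_cell T k M) s = push k (rows_from T s).
Proof.
elim: s T k => //= x s IHs T k /andP[ltxM als] alT lek.
rewrite (tab_insert_add_cell ltxM alT lek).
have := tab_insert_below ltxM alT; have := tab_insert_size x T.
case: (tab_insert x T) => T' i /= [lei szT'] alT'.
by case: eqP => [eik|_] /=; rewrite IHs // szT'; lia.
Qed.

Lemma tab_from_below M T s : all (fun z => z < M) s -> entries_below M T ->
  entries_below M (tab_from T s).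
Proof.
by elim: s T => //= x s IHs T /andP[ltx als] alT; apply/IHs/tab_insert_below.
Qed.

(** [M] enters at the end of row 0, and from then on it affects the later indices only through
    [push]. *)
Lemma rows_max M p q :
    all (fun z => z < M) p -> all (fun z => z < M) q ->
  rows (p ++ M :: q) = rows p ++ 0 :: push 0 (drop (size p) (rows (p ++ q))).
Proof.
move=> alp alq; rewrite /rows !rows_from_cat /=.
have alT := @tab_from_below M [::] p alp isT.
by rewrite tab_insert_max //= rows_from_add_cell // drop_size_cat // size_rows_from.
Qed.

Lemma rows_cat_max M p q : all (fun z => z < M) (p ++ q) ->
  exists tau, [/\ rows (p ++ q) = rows p ++ tau, size tau = size q &
    rows (p ++ M :: q) = rows p ++ 0 :: push 0 tau].
Proof.
rewrite all_cat => /andP[alp alq]; have [tau E sz] := rows_cat p q.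
by exists tau; split=> //; rewrite rows_max // E drop_size_cat // size_rows.
Qed.

(** Weaker than the ballot condition: with [m] rows present, it records only that new rows are
    opened in order. *)
Fixpoint lattice (m : nat) (tau : seq nat) : bool :=
  if tau is i :: tau' then (i <= m) && lattice (maxn m i.+1) tau' else true.

Lemma lattice_rows_from T s : lattice (size T) (rows_from T s).
Proof.
elim: s T => //= x s IHs T; have [-> <-] := tab_insert_size x T.
exact: IHs.
Qed.

Lemma lattice_cat m t1 t2 : lattice m (t1 ++ t2) ->
  lattice m t1 /\ lattice (foldl (fun m i => maxn m i.+1) m t1) t2.
Proof.
by elim: t1 m => //= i t1 IH m /andP[-> /IH[-> ?]].
Qed.

Lemma lattice_rows s : lattice 0 (rows s).
Proof. exact: lattice_rows_from. Qed.

Lemma rows_cons x s : exists tau, rows (x :: s) = 0 :: tau /\ lattice 1 tau.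
Proof.
exists (rows_from (tab_insert x [::]).1 s); split=> //.
exact: (lattice_rows_from [:: [:: x]]).
Qed.

(** * Local rules on shapes *)

(* Shapes are represented by their row-length functions [nat -> nat]. *)
Definition incr (f : nat -> nat) (a i : nat) : nat := (i == a) + f i.

Definition is_part (f : nat -> nat) := forall i j, i <= j -> f j <= f i.

Lemma incrC f a b : incr (incr f a) b = incr (incr f b) a.
Proof. by apply: functional_extensionality => i; rewrite /incr addnCA. Qed.

Lemma incr_inj f : injective (incr f).
Proof.
move=> a b /(congr1 (fun g => g a)); rewrite /incr eqxx.
by case: (a =P b) => // _; lia.
Qed.

Lemma is_part_incr f a : is_part f -> (forall i, i < a -> f a < f i) ->
  is_part (incr f a).
Proof.
move=> fp lta i j leij; have := fp i j leij; rewrite /incr.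
case: (j =P a) => [eqj|_]; last lia.
by case: (i =P a) => [->|neqi]; last (have := lta i); rewrite -?eqj; lia.
Qed.

Lemma is_part_incr_lt f a i : is_part (incr f a) -> i < a -> f a < f i.
Proof. by move=> fp ltia; have := fp i a (ltnW ltia); rewrite /incr; lia. Qed.

Lemma is_part_incr2 f a b : is_part (incr f a) -> is_part (incr f b) ->
  a != b -> is_part (incr (incr f a) b).
Proof.
move=> fpa fpb neqab; apply: is_part_incr => // i ltib.
by have := is_part_incr_lt fpb ltib; rewrite /incr; lia.
Qed.

(** Among rows of equal length only the topmost can be extended, so an addable cell is determined by
    its column. *)
Lemma addable_inj f a b : is_part (incr f a) -> is_part (incr f b) ->
  f a = f b -> a = b.
Proof.
move=> fpa fpb eqab; case: (ltngtP a b) => // lt.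
  by have := is_part_incr_lt fpb lt; lia.
by have := is_part_incr_lt fpa lt; lia.
Qed.

(* The two directions of a square of shapes add a cell in rows [a] and [b] to
   its lower corner; [a'] and [b'] are the rows on the opposite sides. *)
Definition square_rule (N : (nat -> nat) -> nat -> nat -> Prop)
    (f : nat -> nat) (a b a' b' : nat) : Prop :=
  if a == b then a' = b' /\ N f a a' else a' = a /\ b' = b.

Definition square N (f g h k : nat -> nat) : Prop :=
  exists a b a' b',
    [/\ g = incr f a, h = incr f b, k = incr g b', k = incr h a' &
        square_rule N f a b a' b'].

(* Coinciding cells: the other cell goes to the next row when the two directions
   are the last and the largest letter, to the next column for the first and the
   largest letter, and forms a domino with the old one for the first and the last
   letter. *)
Definition next_row (f : nat -> nat) (a p : nat) : Prop := p = a.+1.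

(** With columns counted from 0, the first cell lies in column [f a], and the next cell of row [p]
    then lies in column [f a + 1]. *)
Definition next_column (f : nat -> nat) (a p : nat) : Prop :=
  incr f a p = (f a).+1.

Definition domino (f : nat -> nat) (a p : nat) : Prop :=
  p = a \/ (p = a.+1 /\ f a.+1 = f a).

(** When the cells coincide in row [a], that row has just grown, which makes room for a cell in row
    [a + 1]. *)
Lemma square_next_row_part f g h k : is_part f -> is_part g -> is_part h ->
  square next_row f g h k -> is_part k.
Proof.
move=> fp gp hp [a [b [a' [b' [Eg Eh -> _]]]]]; subst g h.
rewrite /square_rule; case: (a =P b) => [eqab|/eqP neqab] [].
  move=> <- ->; apply: is_part_incr => // i lei.
  have := fp a a.+1; have := @is_part_incr_lt _ _ i gp; rewrite /incr.
  by case: (i =P a) => [->|]; lia.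
by move=> _ ->; apply: is_part_incr2.
Qed.

Lemma square_mem N f g h k a b :
  square N f g h k -> g = incr f a -> h = incr f b ->
  exists a' b', [/\ k = incr (incr f a) b', k = incr (incr f b) a' &
     square_rule N f a b a' b'].
Proof.
case=> a1 [b1 [a' [b' [-> -> -> E sq]]]] /incr_inj eqa /incr_inj eqb.
by exists a', b'; rewrite -eqa -eqb; split.
Qed.

(* The consistency of the three rules around the cube spanned by the first
   letter x, the last letter y and the largest letter m. *)
Lemma cube f fx fy fm fxy fxm fym fxym :
    is_part f -> is_part fx -> is_part fy -> is_part fm ->
    is_part fxy -> is_part fxm -> is_part fym -> is_part fxym ->
    square domino f fx fy fxy -> square next_column f fx fm fxm ->
    square next_row f fy fm fym -> square next_row fx fxy fxm fxym ->
  square domino fm fxm fym fxym /\ square next_column fy fxy fym fxym.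
Proof.
move=> pf px py pm pxy pxm pym pxym Sxy Sxm Sym Sx.
(* [a], [b], [c] are the rows in which x, y, m extend [f]; a suffix, as in [a_y], gives the row for
   the same direction once the suffixed letters are present. *)
case: (Sxy) => a [b [a_y [b_x [Ex Ey Exy Exy' Rxy]]]].
case: (Sxm) => _ [c [_ [_ [_ Em _ _ _]]]].
have [a_m [c_x [Exm Exm' Rxm]]] := square_mem Sxm Ex Em.
have [b_m [c_y [Eym Eym' Rym]]] := square_mem Sym Ey Em.
rewrite -Ex in Exm; rewrite -Em in Exm' Eym'; rewrite -Ey in Eym.
have [b_xm [c_xy [Ek Ek' Rx]]] := square_mem Sx Exy Exm.
rewrite -Exy in Ek; rewrite -Exm in Ek'.
(* The one unknown edge of the cube is the x-edge from [fym] to [fxym]; its row must satisfy the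
   rules of both remaining faces. *)
suff [a' [Ea' RL RC]] : exists a', [/\ fxym = incr fym a',
    square_rule domino fm a_m b_m a' b_xm &
    square_rule next_column fy a_y c_y a' c_xy].
  split; first by exists a_m, b_m, a', b_xm.
  by exists a_y, c_y, a', c_xy.
have incrE g i j : incr g i j = (j == i) + g j by [].
move: Rxy Rxm Rym Rx; rewrite /square_rule /next_row.
have [eqab|neqab] := eqVneq a b => -[Ry1 Ry2].
  subst b; have [eqac|neqac] := eqVneq a c => -[Rm1 Rm2].
    subst c => -[Rb1 Rb2]; subst b_m c_y b_x c_x.
    (* All three cells coincide. A horizontal domino of x and y forces [a_m = a], as the column rule
       leaves one addable cell; a vertical one excludes [a_m = a + 1], since that row is still too
       short. *)
    case: Ry2 => [eqay|[eqay feq]].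
      subst a_y; have eqm : a_m = a.
        by apply: (@addable_inj fx); rewrite -?Exm -?Exy // Ex Rm2 incrE eqxx.
      subst a_m; rewrite eqxx => -[Rx1 Rx2]; subst b_xm c_xy.
      exists a; rewrite (_ : (a == a.+1) = false); last lia.
      by split=> //; subst; apply: functional_extensionality => i; rewrite !incrE; lia.
    subst a_y; have neqm : a.+1 != a_m.
      by apply/eqP=> eqm; move: Rm2; rewrite /next_column -eqm incrE; lia.
    rewrite (negPf neqm) => -[Rx1 Rx2]; subst b_xm c_xy.
    exists a_m; rewrite eq_sym (negPf neqm) eqxx; split=> //.
      by subst; apply: functional_extensionality => i; rewrite !incrE; lia.
    split=> //; move: Rm2; rewrite /next_column; subst; rewrite !incrE; lia.
  move=> [Rb1 Rb2]; subst a_m c_x b_m c_y b_x.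
  (* Equality would need a vertical domino, whose lower cell is not addable to [f] itself. *)
  have neqc : a_y != c.
    apply/eqP=> eqc; case: Ry2 => [|[eqa' feq]]; first by move/eqP: neqac; lia.
    rewrite Em -eqc eqa' in pm; have := is_part_incr_lt (i := a) pm; lia.
  rewrite (negPf neqc) => -[Rx1 Rx2]; subst b_xm c_xy; exists a_y.
  rewrite ?eqxx; split=> //.
    by subst; apply: functional_extensionality => i; rewrite !incrE; lia.
  split=> //; case: Ry2 => [->|[eqa' feq]]; [by left | right; split=> //].
  by rewrite Em !incrE feq; lia.
have [eqac|neqac] := eqVneq a c => -[Rm1 Rm2].
  subst c; rewrite eq_sym (negPf neqab) => -[Rb1 Rb2].
  subst a_y b_x a_m b_m c_y; rewrite ?eqxx.
  have [eqc|neqc] := eqVneq b c_x => -[Rx1 Rx2].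
    (* b lies in the column next to a, and the new cell is right below b *)
    subst c_x b_xm c_xy; exists b.+1; rewrite ?eqxx.
    have fb : f b = (f a).+1 by move: Rm2; rewrite /next_column incrE; lia.
    have ltba : b < a by rewrite ltnNge; apply/negP=> /pf; lia.
    have eqfa : (b.+1 == a) + f b.+1 = (f a).+1.
      rewrite Em in pm; have := is_part_incr_lt (i := b.+1) pm.
      by have := pf b b.+1; case: (b.+1 =P a) => [->|]; lia.
    split; first by subst; apply: functional_extensionality => i; rewrite !incrE; lia.
      by split=> //; right; split=> //; rewrite Em !incrE; lia.
    by split=> //; rewrite /next_column Ey !incrE; lia.
  subst b_xm c_xy; exists c_x; split=> //.
    by subst; apply: functional_extensionality => i; rewrite !incrE; lia.
  split=> //; move: Rm2; rewrite /next_column Ey !incrE; lia.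
have [eqbc|neqbc] := eqVneq b c => -[Rb1 Rb2].
  subst c a_y b_x a_m c_x b_m c_y; rewrite ?eqxx => -[Rx1 Rx2]; subst b_xm c_xy.
  (* Above [fy] the cell of m has been pushed to row [b + 1], where it may meet the cell of x; the
     new cell then lies beside it in the same row. *)
  have [eqa|neqa] := eqVneq a b.+1.
    subst a; exists b.+1; split.
      by subst; apply: functional_extensionality => i; rewrite !incrE; lia.
      by split=> //; left.
    by split=> //; rewrite /next_column incrE eqxx.
  exists a; split=> //.
  by subst; apply: functional_extensionality => i; rewrite !incrE; lia.
subst b_m c_y a_y b_x a_m c_x; rewrite (negPf neqbc) => -[Rx1 Rx2].
subst b_xm c_xy; exists a; rewrite (negPf neqab) (negPf neqac); split=> //.
by subst; apply: functional_extensionality => i; rewrite !incrE; lia.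
Qed.

(** * Shapes of words *)

Definition content (tau : seq nat) (i : nat) : nat := count_mem i tau.

Arguments content tau i : simpl never.

Definition word_shape (s : seq nat) : nat -> nat := content (rows s).

Lemma content_cons i tau : content (i :: tau) = incr (content tau) i.
Proof. by apply: functional_extensionality => j; rewrite /content /incr /= eq_sym. Qed.

Lemma content_rcons i tau : content (rcons tau i) = incr (content tau) i.
Proof.
rewrite -content_cons; apply: functional_extensionality => j.
by rewrite /content -cats1 count_cat /= addn0 addnC.
Qed.

Lemma word_shape_rcons s x :
  exists2 i, rows (rcons s x) = rcons (rows s) i &
             word_shape (rcons s x) = incr (word_shape s) i.
Proof.
by have [i E] := rows_rcons s x; exists i; rewrite // /word_shape E content_rcons.
Qed.

(** Two counts of one shape: the cell of the maximal letter is charged to the row where it starts or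
    to the row where it ends. *)
Lemma content_push k tau :
  incr (content (push k tau)) k = incr (content tau) (push_end k tau).
Proof.
elim: tau k => //= i tau IH k; case: eqP => [->|_].
  by rewrite !content_cons IH -[RHS]incrC -(IH k.+1) incrC.
by rewrite !content_cons incrC IH incrC.
Qed.

(** The local rule for the pair (last, largest) is one step of [push], applied to the index of [y]
    with [M] sitting in row [push_end 0 tau]. *)
Lemma square_max M s1 s2 y : all (fun z => z < M) (s1 ++ s2) -> y < M ->
  square next_row (word_shape (s1 ++ s2)) (word_shape (rcons (s1 ++ s2) y))
    (word_shape (s1 ++ M :: s2)) (word_shape (rcons (s1 ++ M :: s2) y)).
Proof.
move=> alM lty; have al2 : all (fun z => z < M) (s1 ++ rcons s2 y).
  by rewrite -rcons_cat all_rcons lty.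
have shM q : all (fun z => z < M) (s1 ++ q) -> exists tau,
    [/\ rows (s1 ++ q) = rows s1 ++ tau,
        rows (s1 ++ M :: q) = rows s1 ++ 0 :: push 0 tau &
        word_shape (s1 ++ M :: q) = incr (word_shape (s1 ++ q)) (push_end 0 tau)].
  case/rows_cat_max=> tau [E _ EM]; exists tau; split=> //.
  apply: functional_extensionality => j; rewrite /word_shape E EM /content.
  rewrite /incr !count_cat addnCA; congr (_ + _).
  by have := congr1 (@^~ j) (content_push 0 tau); rewrite /incr /content /= eq_sym.
have [tau [E1 E2 E3]] := shM _ alM; have [tau' [E1' E2' E3']] := shM _ al2.
have [i Ei Ei'] := word_shape_rcons (s1 ++ s2) y.
have [j Ej Ej'] := word_shape_rcons (s1 ++ M :: s2) y.
have Etau : tau' = rcons tau i.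
  move: E1'; rewrite -rcons_cat Ei E1 rcons_cat => /eqP.
  by rewrite eqseq_cat // eqxx => /eqP.
subst tau'; set k := push_end 0 tau in E3.
have Ek : push_end 0 (rcons tau i) = if i == k then k.+1 else k.
  by rewrite -cats1 push_end_cat /=.
have jE : j = if i == k then k.+1 else i.
  have /eqP := Ej; rewrite rcons_cat rcons_cons E2' E2 -!cats1 push_cat /= -/k.
  rewrite -catA eqseq_cat //= eqxx eqseq_cons eqxx eqseq_cat // eqxx /=.
  by case: ifP => _ /eqP[].
exists i, k, j, (if i == k then k.+1 else k); split=> //.
  by rewrite rcons_cat rcons_cons E3' Ek rcons_cat.
by rewrite /square_rule jE; case: eqP => // ->.
Qed.

Lemma word_shape_rcons_max M s : all (fun z => z < M) s ->
  word_shape (rcons s M) = incr (word_shape s) 0.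
Proof.
move=> alM; have [|tau [_ /size0nil-> E]] := @rows_cat_max M s [::]; first by rewrite cats0.
by rewrite -cats1 /word_shape E /= cats1 content_rcons.
Qed.

Lemma max_split s : uniq s -> s != [::] ->
  exists M s1 s2, s = s1 ++ M :: s2 /\ all (fun z => z < M) (s1 ++ s2).
Proof.
move=> us nz; pose M := \max_(x <- s) x.
have Ms : M \in s.
  rewrite /M; elim: s nz {us M} => //= x [|y s] IHs _; first by rewrite big_seq1 mem_head.
  rewrite big_cons; case: (leqP x (\max_(i <- y :: s) i)) => _; last exact: mem_head.
  by rewrite inE IHs ?orbT.
case/splitPr defs : {1}s / Ms us => [s1 s2] us; exists M, s1, s2; split=> //.
apply/allP=> z; rewrite mem_cat => zs; rewrite ltn_neqAle; apply/andP; split.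
  apply/eqP=> eqz; move: us; rewrite cat_uniq /= -eqz.
  by case/orP: zs => ->; rewrite /= ?orbT ?andbF.
rewrite /M; apply: (@leq_bigmax_seq _ s xpredT id) => //; rewrite defs mem_cat inE.
by case/orP: zs => ->; rewrite ?orbT.
Qed.

(** Induction deleting the largest and the last letter: the local rule carries the partition
    property from three corners of the square to the fourth. *)
Lemma is_part_word_shape s : uniq s -> is_part (word_shape s).
Proof.
have [n] := ubnP (size s); elim: n s => // n IHn s; case/lastP: s => [//|s y].
rewrite size_rcons ltnS => lts us.
have us1 : uniq s by move: us; rewrite rcons_uniq => /andP[].
have [] := max_split us; first by case: (s).
move=> M [s1 [s2 [defs alM]]].
case/lastP: s2 => [|s2 z] in defs alM.
  move: defs; rewrite cats1 => /rcons_inj[es ey]; subst s1 y.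
  rewrite cats0 in alM; rewrite word_shape_rcons_max //.
  by apply: is_part_incr => //; apply: IHn.
move: defs; rewrite -rcons_cons -rcons_cat => /rcons_inj[es ey]; subst s z.
move: alM; rewrite -rcons_cat all_rcons => /andP[lty alM].
have szE : size (s1 ++ M :: s2) = (size (s1 ++ s2)).+1 by rewrite !size_cat /= addnS.
have us2 : uniq (rcons (s1 ++ s2) y).
  apply: subseq_uniq us; rewrite -!cats1; apply: cat_subseq => //.
  by apply: cat_subseq => //; apply: subseq_cons.
apply: square_next_row_part (square_max alM lty); apply: IHn => //.
- by rewrite -szE ltnW.
- by move: us2; rewrite rcons_uniq => /andP[].
- by rewrite size_rcons -szE.
Qed.

(** A maximal first letter stays in the first column: if a new cell of [s] takes its place in row
    [p], it moves to row [p + 1], which is empty by monotonicity. *)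
Lemma word_shape_cons_max M s : uniq s -> all (fun z => z < M) s ->
  exists2 p, word_shape (M :: s) = incr (word_shape s) p & word_shape s p = 0.
Proof.
elim/last_ind: s => [_ _|s y IHs].
  exists 0 => //; apply: functional_extensionality => j.
  by rewrite /incr /word_shape /content /= eq_sym.
rewrite rcons_uniq all_rcons => /andP[_ us] /andP[lty alM].
have [p Ep sp0] := IHs us alM.
have [a [b [a' [b' [Eg Eh Ek Ek' R]]]]] := @square_max M [::] s y alM lty.
rewrite /= in Eg Eh Ek Ek'.
have eqb : p = b by apply: (@incr_inj (word_shape s)); rewrite -Ep.
subst b; exists b' => //; rewrite Eg /incr.
have := is_part_word_shape us (leqnSn p); move: R; rewrite /square_rule /next_row.
by case: eqP => [-> [<- ->]|neqa [_ ->]]; lia.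
Qed.

(** * Local rules involving the first letter *)

Definition first_last_rule x v y :=
  square domino (word_shape v) (word_shape (x :: v))
    (word_shape (rcons v y)) (word_shape (x :: rcons v y)).

Definition first_max_rule x s1 M s2 :=
  square next_column (word_shape (s1 ++ s2)) (word_shape (x :: s1 ++ s2))
    (word_shape (s1 ++ M :: s2)) (word_shape (x :: s1 ++ M :: s2)).

Lemma word_shape_cons_of x v :
    (forall v' y, v = rcons v' y -> first_last_rule x v' y) ->
  exists a, word_shape (x :: v) = incr (word_shape v) a.
Proof.
case/lastP: v => [_|v y /(_ v y erefl)].
  by exists 0; rewrite -[[:: x]]/(rcons [::] x) word_shape_rcons_max.
by case=> a [b [a' [b' [_ _ _ -> _]]]]; exists a'.
Qed.

(** A maximal last letter always lands in row 0, so it does not change the row of the cell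
    contributed by [x]; if that row is 0 too, the two cells form a horizontal domino. *)
Lemma first_last_rule_max x v M :
    (exists a, word_shape (x :: v) = incr (word_shape v) a) ->
    all (fun z => z < M) (x :: v) ->
  first_last_rule x v M.
Proof.
move=> [a Ea] alM; have /andP[_ alM'] := alM; exists a, 0, a, 0.
rewrite /square_rule -rcons_cons word_shape_rcons_max //.
rewrite word_shape_rcons_max // Ea; split=> //.
  exact: incrC.
by case: eqP => // ->; split=> //; left.
Qed.

Lemma first_max_rule_last x v M :
    (exists a, word_shape (x :: v) = incr (word_shape v) a) ->
    all (fun z => z < M) (x :: v) ->
  first_max_rule x v M [::].
Proof.
move=> [a Ea] alM; have /andP[_ alM'] := alM; exists a, 0, a, 0.
rewrite /square_rule cats0 cats1 -rcons_cons word_shape_rcons_max //.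
rewrite word_shape_rcons_max // Ea; split=> //.
  exact: incrC.
by case: eqP => // ->; split=> //; rewrite /next_column /incr eqxx.
Qed.

(** A maximal first letter contributes the lowest cell of the first column. If [y] claims the same
    cell, that of [M] goes right below it, giving a vertical domino. *)
Lemma first_last_rule_first_max v y M : uniq (rcons v y) ->
    all (fun z => z < M) (rcons v y) ->
  first_last_rule M v y.
Proof.
move=> uvy alM; have [a' Ea' a'0] := word_shape_cons_max uvy alM.
have uv : uniq v by move: uvy; rewrite rcons_uniq => /andP[].
have /andP[lty alM'] : (y < M) && all (fun z => z < M) v by move: alM; rewrite all_rcons.
have [a Ea a0] := word_shape_cons_max uv alM'.
have [b _ Eb] := word_shape_rcons v y.
have uM w : uniq w -> all (fun z => z < M) w -> uniq (M :: w).
  by move=> uw /allP alw /=; rewrite uw andbT; apply/negP=> /alw; rewrite ltnn.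
have pa := is_part_word_shape (uM _ uv alM').
have pb := is_part_word_shape uvy; have pk := is_part_word_shape (uM _ uvy alM).
have pv := is_part_word_shape uv.
rewrite Ea in pa; rewrite Ea' Eb in pk; rewrite Eb in pb a'0 Ea'.
exists a, b, a', (if a == b then a.+1 else b); rewrite /square_rule Ea' Ea Eb.
case: (eqVneq a b) => [eqab|neqab].
  subst b; have eqa' : a' = a.+1.
    apply: (addable_inj pk); last by rewrite a'0 /incr; have := pv a a.+1; lia.
    apply: is_part_incr => // i lei; rewrite /incr.
    have := @is_part_incr_lt _ _ i pb; have := pv a a.+1.
    by case: (i =P a) => [->|]; lia.
  subst a'; split=> //; split=> //; right; split=> //.
  by have := pv a a.+1; lia.
have eqa' : a' = a.
  apply: (addable_inj pk); last by rewrite a'0 /incr a0 (negPf neqab).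
  by rewrite eq_sym in neqab; apply: is_part_incr2.
by subst a'; split=> //; rewrite incrC.
Qed.

(** Simultaneous induction on the length. If the first, last and largest letters are distinct,
    [cube] applies; the cases where the largest letter comes first or last were treated directly. *)
Lemma local_rules n :
  (forall x v y, uniq (x :: rcons v y) -> size v < n -> first_last_rule x v y) /\
  (forall x s1 M s2, uniq (x :: s1 ++ M :: s2) -> all (fun z => z < M) (x :: s1 ++ s2) ->
     size (s1 ++ s2) < n -> first_max_rule x s1 M s2).
Proof.
elim: n => // n [IHL IHC].
have consE x v : uniq (x :: v) -> size v <= n ->
    exists a, word_shape (x :: v) = incr (word_shape v) a.
  move=> uxv lev; apply: word_shape_cons_of => v' y Ev.
  by apply: IHL; rewrite -?Ev //; move: lev; rewrite Ev size_rcons.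
(* Of the four known faces, two come from the induction hypotheses, for the words without [M] and
   without [y], and two from [square_max], without and with [x]. *)
have main x s1 M s2 y : uniq (x :: rcons (s1 ++ M :: s2) y) ->
    all (fun z => z < M) (x :: rcons (s1 ++ s2) y) -> size (s1 ++ s2) < n ->
    first_last_rule x (s1 ++ M :: s2) y /\ first_max_rule x s1 M (rcons s2 y).
  move=> us al lts; have sub : subseq (s1 ++ s2) (s1 ++ M :: s2).
    by apply: cat_subseq => //; apply: subseq_cons.
  have subr : subseq (rcons (s1 ++ s2) y) (rcons (s1 ++ M :: s2) y).
    by rewrite -!cats1; apply: cat_subseq.
  have subx w w' : subseq w w' -> subseq (x :: w) (x :: w') by rewrite /= eqxx.
  have us' := subseq_uniq (subx _ _ subr) us.
  have uB : uniq (x :: s1 ++ M :: s2).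
    by apply: subseq_uniq us; apply: subx; apply: subseq_rcons.
  have uA := subseq_uniq (subx _ _ sub) uB.
  have unx w : uniq (x :: w) -> uniq w by case/andP.
  have /and3P[ltx lty al'] : [&& x < M, y < M & all (fun z => z < M) (s1 ++ s2)].
    by move: al; rewrite /= all_rcons.
  have alx : all (fun z => z < M) ((x :: s1) ++ s2) by rewrite /= ltx.
  have pw w : uniq (x :: w) -> is_part (word_shape w) by move/unx/is_part_word_shape.
  have [L C] := cube (pw _ uA) (is_part_word_shape uA) (pw _ us') (pw _ uB)
    (is_part_word_shape us') (is_part_word_shape uB) (pw _ us) (is_part_word_shape us)
    (IHL _ _ _ us' lts) (IHC _ _ _ _ uB alx lts) (square_max al' lty) (square_max alx lty).
  by split; [exact: L | rewrite /first_max_rule -rcons_cons -!rcons_cat].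
split=> [x v y us ltv|x s1 M s2 us al lts].
  have [//|M [s1 [s2 []]]] := max_split us.
  have uv : uniq (x :: v) by apply: subseq_uniq us; rewrite /= eqxx subseq_rcons.
  case: s1 => [[<- <-] al|x' s1 [<-]].
    by apply: first_last_rule_first_max => //; case/andP: us.
  case/lastP: s2 => [|s2 z].
    rewrite cats1 cats0 => /rcons_inj[<- <-] al.
    by apply: first_last_rule_max => //; apply: consE.
  rewrite -rcons_cons -rcons_cat => /rcons_inj[Ev <-] al; subst v.
  apply: (main x s1 M s2 y us _ _).1; first by rewrite rcons_cat.
  by move: ltv; rewrite !size_cat /= addnS.
case/lastP: s2 => [|s2 y] in us al lts *.
  rewrite cats0 in al lts.
  have us1 : uniq (x :: s1).
    by apply: subseq_uniq us; rewrite /= eqxx -{1}[s1]cats0; apply: cat_subseq.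
  by apply: first_max_rule_last => //; apply: consE.
move: us lts al; rewrite -rcons_cons -!rcons_cat size_rcons ltnS => us lts al.
exact: (main x s1 M s2 y us al lts).2.
Qed.

Lemma first_last x v y : uniq (x :: rcons v y) -> first_last_rule x v y.
Proof. by move=> us; apply: (local_rules (size v).+1).1. Qed.

Lemma first_max x s1 M s2 : uniq (x :: s1 ++ M :: s2) ->
  all (fun z => z < M) (x :: s1 ++ s2) -> first_max_rule x s1 M s2.
Proof. by move=> us al; apply: (local_rules (size (s1 ++ s2)).+1).2. Qed.

(** * Reversal transposes the shape *)

Definition conj_shape (f g : nat -> nat) := forall i j, (j < f i) = (i < g j).

Lemma conj_shape_sym f g : conj_shape f g -> conj_shape g f.
Proof. by move=> cfg i j; rewrite cfg. Qed.

Lemma conj_shape_inj f g h : conj_shape f g -> conj_shape f h -> g = h.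
Proof.
move=> cg ch; apply: functional_extensionality => j.
case: (ltngtP (g j) (h j)) => //.
  by rewrite -(ch (g j) j) cg ltnn.
by rewrite -(cg (h j) j) ch ltnn.
Qed.

(** The cell added in row [a] lies in column [f a], which is the row of the transposed cell. *)
Lemma conj_shape_incr f g a : is_part f -> is_part (incr f a) ->
  conj_shape f g -> g (f a) = a /\ conj_shape (incr f a) (incr g (f a)).
Proof.
move=> pf pa cfg; have ga : g (f a) = a.
  apply/eqP; rewrite eqn_leq leqNgt -cfg ltnn /=; case: a pa => // a pa.
  by rewrite -cfg; apply: is_part_incr_lt pa _.
split=> // i j; rewrite /incr; have := cfg i j.
case: (i =P a) => [->|neqi]; case: (j =P f a) => [->|neqj]; rewrite ?ga //; lia.
Qed.

(** Induction deleting the first and the largest letter. The first letter becomes the last in the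
    reverse, and the rules [next_column] and [next_row] for these two pairs are transposes of each
    other. *)
Lemma conj_word_shape_rev s : uniq s -> conj_shape (word_shape s) (word_shape (rev s)).
Proof.
have [n] := ubnP (size s); elim: n s => // n IHn [|x s] lts us; first by [].
have us1 : uniq s by case/andP: us.
have [//|M [s1 [s2 []]]] := max_split us.
case: s1 => [[<- <-] al|x' s1 [<- Es]].
  rewrite rev_cons word_shape_rcons_max ?all_rev //.
  have [p Ep p0] := word_shape_cons_max us1 al.
  have ps := is_part_word_shape us1; have px := is_part_word_shape us.
  rewrite Ep in px *; have := conj_shape_incr ps px (IHn s lts us1).
  by rewrite p0 => -[].
subst s => al; have al' := al; case/andP: al' => ltx al'.
have uA : uniq (x :: s1 ++ s2).
  by apply: subseq_uniq us; rewrite /= eqxx; apply: cat_subseq => //; apply: subseq_cons.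
have uB : uniq (s1 ++ s2) by case/andP: uA.
have szE : size (s1 ++ M :: s2) = (size (s1 ++ s2)).+1 by rewrite !size_cat /= addnS.
rewrite /= szE ltnS in lts.
have [a [c [a' [c' [Ea Ec Ek Ek' R]]]]] := first_max us al.
have rsz : all (fun z => z < M) (rev s2 ++ rev s1) by rewrite -rev_cat all_rev.
have := square_max rsz ltx; rewrite -rev_cat -rev_cons.
have -> : rev s2 ++ M :: rev s1 = rev (s1 ++ M :: s2).
  by rewrite rev_cat rev_cons cat_rcons.
rewrite -rev_cons => -[ra [rc [ra' [rc' [rEa rEc rEk _ rR]]]]].
have c0 := IHn _ (ltnW lts) uB.
have ca : conj_shape (word_shape (x :: s1 ++ s2)) (word_shape (rev (x :: s1 ++ s2))).
  exact: IHn uA.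
have cc : conj_shape (word_shape (s1 ++ M :: s2)) (word_shape (rev (s1 ++ M :: s2))).
  by apply: IHn => //; rewrite szE.
have p0 := is_part_word_shape uB; have pa := is_part_word_shape uA.
have pc := is_part_word_shape us1; have pk := is_part_word_shape us.
have [_ ca'] := conj_shape_incr p0 (eq_ind _ is_part pa _ Ea) c0.
have [_ cc'] := conj_shape_incr p0 (eq_ind _ is_part pc _ Ec) c0.
rewrite Ea rEa in ca; rewrite Ec rEc in cc.
have Era : ra = word_shape (s1 ++ s2) a.
  exact: incr_inj (conj_shape_inj ca ca').
have Erc : rc = word_shape (s1 ++ s2) c.
  exact: incr_inj (conj_shape_inj cc cc').
rewrite Ea in pa Ek; rewrite Ec in pc; rewrite Ek in pk *; rewrite rEk rEa Era.
have [_] := conj_shape_incr pa pk ca'.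
suff -> : rc' = incr (word_shape (s1 ++ s2)) a c' by [].
move: R rR; rewrite /square_rule.
case: (eqVneq a c) => [eqac [<- ->]|neqac [_ ->]].
  by rewrite Era Erc eqac eqxx /next_row => -[<- ->].
(* Equal rows on the reversed side mean equal columns here, so the two addable cells would
   coincide. *)
case: (eqVneq ra rc) => [eqr|_ [_ ->]]; last by rewrite /incr eq_sym (negPf neqac).
by move: neqac; rewrite (addable_inj pa pc) ?eqxx // -Era -Erc.
Qed.

(** * Deleting the first letter *)

(** A cell addable to [f] in a row other than [a] never forms a domino with the cell of row [a].
    Hence [p] reveals whether the two directions coincide, and with it the row [b]. *)
Lemma domino_determined f a p b b' g1 g2 :
  is_part (incr f b) -> is_part (incr f b') ->
  square_rule domino f a b g1 p -> square_rule domino f a b' g2 p -> b = b'.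
Proof.
move=> pb pb'; rewrite /square_rule.
have key c : is_part (incr f c) -> a != c -> ~ domino f a c.
  move=> pc neqac [eqc|[eqc feq]]; first by rewrite eqc eqxx in neqac.
  by subst c; have := is_part_incr_lt pc (ltnSn a); rewrite feq ltnn.
case: (eqVneq a b) => [eqab [-> N]|neqab [_ eqp]];
  case: (eqVneq a b') => [eqab' [eqp' N']|neqab' [_ eqp']].
- by rewrite -eqab.
- by case: (key b' pb' neqab'); rewrite -eqp'.
- by case: (key b pb neqab); rewrite -eqp -eqp'.
- by rewrite -eqp -eqp'.
Qed.

(** Induction on the last letter: the (first, last) square is solved for the cell that [y] adds to
    the shape of [v], with a unique solution by [domino_determined]. *)
Lemma rows_behead x v x' v' : uniq (x :: v) -> uniq (x' :: v') -> size v = size v' ->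
  rows (x :: v) = rows (x' :: v') -> rows v = rows v'.
Proof.
elim/last_ind: v v' => [|v y IHv] v'; first by case: v'.
case/lastP: v' => [|v' y']; first by rewrite size_rcons.
rewrite !size_rcons -!rcons_cons => ux ux' [eqsz] eqr.
have [u u'] : uniq (x :: v) /\ uniq (x' :: v').
  by move: ux ux'; rewrite !rcons_uniq => /andP[_ ?] /andP[_ ?].
have [i Ei _] := word_shape_rcons (x :: v) y.
have [i' Ei' _] := word_shape_rcons (x' :: v') y'.
move: eqr; rewrite Ei Ei' => /rcons_inj eqri.
have eqr : rows (x :: v) = rows (x' :: v') := congr1 fst eqri.
have eqi : i = i' := congr1 snd eqri.
have eqv := IHv v' u u' eqsz eqr.
have [j Ej Sj] := word_shape_rcons v y; have [j' Ej' Sj'] := word_shape_rcons v' y'.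
rewrite Ej Ej' eqv; congr rcons.
have eqS : word_shape v = word_shape v' by rewrite /word_shape eqv.
have eqSx : word_shape (x :: v) = word_shape (x' :: v') by rewrite /word_shape eqr.
have [a [b [a' [p [Ea Eb Ek _ R]]]]] := first_last ux.
have [c [b2 [c' [p2 [Ec Eb2 Ek2 _ R2]]]]] := first_last ux'.
have -> : j = b by apply: (@incr_inj (word_shape v)); rewrite -Sj -Eb.
have -> : j' = b2 by apply: (@incr_inj (word_shape v')); rewrite -Sj' -Eb2.
have eqac : a = c by apply: (@incr_inj (word_shape v)); rewrite -Ea {1}eqS -Ec.
have eqp : p = p2.
  apply: (@incr_inj (word_shape (x :: v))); rewrite -Ek {1}eqSx -Ek2.
  by rewrite -!rcons_cons /word_shape Ei Ei' eqr eqi.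
subst c p2; rewrite -eqS in Eb2 R2.
apply: domino_determined R R2; rewrite -?Eb -?Eb2.
  by apply: is_part_word_shape; case/andP: ux.
by apply: is_part_word_shape; case/andP: ux'.
Qed.

(** * Descents *)

(** Deleting the largest letter reduces to a shorter word because [push] preserves the comparison of
    two consecutive indices; the cases where that letter is [x] or [y] are explicit. *)
Lemma rows_descent s x y : uniq (rcons (rcons s x) y) ->
  exists i j, rows (rcons (rcons s x) y) = rcons (rcons (rows s) i) j /\
    (i < j) = (y < x).
Proof.
have [n] := ubnP (size s); elim: n s => // n IHn s lts us.
have [|M [s1 [s2 []]]] := max_split us; first by case: (rcons s x).
case/lastP: s2 => [|s2 z].
  rewrite cats1 cats0 => /rcons_inj[<- <-] al.
  have [i Ei] := rows_rcons s x.
  have [|tau [_ /size0nil-> E]] := @rows_cat_max y (rcons s x) [::]; first by rewrite cats0.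
  exists i, 0; rewrite -[rcons (rcons s x) y]cats1 E /= cats1 Ei; split=> //.
  by move: al; rewrite all_rcons => /andP[]; lia.
rewrite -rcons_cons -rcons_cat => /rcons_inj[Es <-].
case/lastP: s2 => [|s2 z'] in Es *.
  move: Es; rewrite cats1 => /rcons_inj[<- <-]; rewrite cats1 => al.
  have [|tau [E sz E']] := @rows_cat_max x s [:: y]; first by rewrite cats1.
  case: tau sz E E' => [//|j []] // _ E E'.
  exists 0, (if j == 0 then 1 else j); rewrite -!cats1 -catA E' /=; split.
    by case: ifP; rewrite -catA.
  by move: al; rewrite all_rcons => /andP[-> _]; case: eqP; lia.
move: Es; rewrite -rcons_cons -rcons_cat => /rcons_inj[Es <-]; subst s.
rewrite -rcons_cat -rcons_cat => al.
have us' : uniq (rcons (rcons (s1 ++ s2) x) y).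
  apply: subseq_uniq us; rewrite -!cats1; do 2 apply: cat_subseq => //.
  by apply: cat_subseq => //; apply: subseq_cons.
have [|i [j [Eij ltij]]] := IHn _ _ us'.
  by move: lts; rewrite !size_cat /= addnS.
have [|t0 [E0 _ E0']] := @rows_cat_max M s1 s2.
  by move: al; rewrite !all_rcons => /and3P[].
have [|tau [E _ E']] := @rows_cat_max M s1 (rcons (rcons s2 x) y).
  by rewrite -!rcons_cat.
have Etau : tau = t0 ++ [:: i; j].
  move: E; rewrite -!rcons_cat Eij E0 -!cats1 -!catA => /eqP.
  by rewrite eqseq_cat // eqxx => /eqP.
move: E'; rewrite Etau push_cat -2!rcons_cons -!rcons_cat => ->.
rewrite E0' /=; set k := push_end 0 t0.
exists (if i == k then k.+1 else i).
exists (if j == (if i == k then k.+1 else k) then (if i == k then k.+1 else k).+1 else j).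
split; last by rewrite -ltij; case: (i =P k) => ?; case: eqP; lia.
by case: ifP => _; case: ifP => _; rewrite -!cats1 -?catA /= -?catA.
Qed.

Definition descents (s : seq nat) : bitseq :=
  mkseq (fun k => nth 0 s k.+1 < nth 0 s k) (size s).-1.

Lemma size_descents s : size (descents s) = (size s).-1.
Proof. exact: size_mkseq. Qed.

Lemma descents_rcons s x y :
  descents (rcons (rcons s x) y) = rcons (descents (rcons s x)) (y < x).
Proof.
rewrite /descents !size_rcons /= /mkseq -[(size s).+1]addn1 iotaD map_cat cats1 /= add0n.
rewrite !nth_rcons !size_rcons !ltnn !eqxx ltnSn; congr rcons.
apply/eq_in_map => k; rewrite mem_iota /= add0n => ltk.
by rewrite !(nth_rcons 0 (rcons s x) y) !size_rcons !ltnS ltk (ltnW ltk).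
Qed.

Lemma descents_rev (s : seq nat) : uniq s -> descents (rev s) = rev (map negb (descents s)).
Proof.
move=> us; apply: (@eq_from_nth _ false) => [|k].
  by rewrite size_rev size_map !size_descents size_rev.
rewrite size_descents size_rev => ltk.
rewrite nth_rev size_map size_descents // (nth_map false) ?size_descents; last lia.
rewrite !nth_mkseq ?size_rev //; last lia.
rewrite !nth_rev; [|lia|lia].
have -> : size s - k.+1 = ((size s).-1 - k.+1).+1 by lia.
have -> : size s - k.+2 = (size s).-1 - k.+1 by lia.
rewrite -leqNgt ltn_neqAle; set i := _ - _.
have lti : i.+1 < size s by rewrite /i; lia.
by rewrite nth_uniq ?(ltnW lti) // (ltn_eqF (ltnSn i)).
Qed.

(** * Hook-shaped words *)

(* The row indices produced by a hook when [m] rows are already occupied: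
   [true] opens a new row, [false] extends the first one. *)
Fixpoint hook_rows (m : nat) (e : bitseq) : seq nat :=
  if e is b :: e' then
    if b then m :: hook_rows m.+1 e' else 0 :: hook_rows m e'
  else [::].

(** The symmetric hook with arm and leg of length [m]. *)
Definition hook_fun (m i : nat) : nat := if i == 0 then m.+1 else i <= m.

Lemma size_hook_rows m e : size (hook_rows m e) = size e.
Proof. by elim: e m => //= -[] e IHe m /=; rewrite IHe. Qed.

Lemma hook_rows_cat m e1 e2 :
  hook_rows m (e1 ++ e2) = hook_rows m e1 ++ hook_rows (m + count id e1) e2.
Proof.
by elim: e1 m => [|[] e1 IHe] m; rewrite /= ?addn0 // IHe ?add0n // addnA addn1.
Qed.

Lemma foldl_hook_rows m e : 0 < m ->
  foldl (fun m i => maxn m i.+1) m (hook_rows m e) = m + count id e.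
Proof.
elim: e m => [|[] e IHe] m m0 /=; first by rewrite addn0.
  by rewrite (maxn_idPr _) // IHe // addnA addn1.
by rewrite (_ : maxn m 1 = m) ?IHe //; lia.
Qed.

Lemma hook_rows_lt m e : 0 < m -> all (fun i => i < m + count id e) (hook_rows m e).
Proof.
elim: e m => //= -[] e IHe m m0 /=; last by rewrite addn_gt0 m0 add0n IHe.
by rewrite addnA addn1 (IHe m.+1) // andbT; lia.
Qed.

Lemma hook_rows_mask m e : 0 < m -> map (fun i => i != 0) (hook_rows m e) = e.
Proof.
by elim: e m => //= -[] e IHe m m0 /=; rewrite IHe //; case: m m0.
Qed.

Lemma content_hook_rows m e i : 0 < m -> content (hook_rows m e) i =
  if i == 0 then count negb e else (m <= i < m + count id e).
Proof.
rewrite /content; elim: e m => [|b e IHe] m m0 /=; first by rewrite addn0; case: eqP; lia.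
case: b => /=; rewrite IHe //; [case: (i =P 0) => [->|] | rewrite eq_sym; case: (i =P 0)]; lia.
Qed.

(** A nonzero index occurs at most once and is at least [m], while [lattice] bounds it by the
    current number of rows; so it always opens the next row. *)
Lemma hook_rows_of_content m tau : 0 < m -> lattice m tau ->
    (forall i, 0 < i -> content tau i <= (m <= i)) ->
  tau = hook_rows m (map (fun i => i != 0) tau).
Proof.
elim: tau m => //= i tau IHt m m0 /andP[leim lat] ct.
have cti j : content tau j <= content (i :: tau) j by rewrite content_cons /incr leq_addl.
case: (i =P 0) => [i0|i0] /=.
  subst i; congr cons; apply: IHt => //; first by rewrite (maxn_idPl _) in lat.
  by move=> j j0; apply: leq_trans (ct j j0).
have eqim : i = m.
  by have := ct i; rewrite content_cons /incr eqxx; lia.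
subst i; congr cons; apply: IHt; rewrite ?(maxn_idPr _) // in lat *.
move=> j j0; have := ct j j0; rewrite content_cons /incr; lia.
Qed.

Lemma rows_hook s : s != [::] -> (forall i, 0 < i -> word_shape s i <= 1) ->
  exists e, rows s = 0 :: hook_rows 1 e.
Proof.
case: s => // x s _ cs; have [tau [E lat]] := rows_cons x s.
exists (map (fun i => i != 0) tau); rewrite E -hook_rows_of_content // => i i0.
by have := cs i i0; rewrite /word_shape E content_cons /incr i0; lia.
Qed.

(** An index opening a new row exceeds all earlier ones and the index 0 exceeds none, so the bits
    compare consecutive indices, which is what [rows_descent] relates to descents. *)
Lemma rows_hook_descents s e : uniq s -> rows s = 0 :: hook_rows 1 e ->
  e = descents s.
Proof.
elim/last_ind: s e => [//|s y IHs] e.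
case/lastP: s IHs => [|s x] IHs us E.
  by apply/size0nil; have := congr1 size E; rewrite size_rows /= size_hook_rows => -[].
have [i [j [Eij ltij]]] := rows_descent us.
have us' : uniq (rcons s x) by move: us; rewrite rcons_uniq => /andP[].
case/lastP: e E => [|e c] E.
  by have := congr1 size E; rewrite size_rows !size_rcons.
move: E; rewrite Eij -[rcons e c]cats1 hook_rows_cat.
have [i' Ei'] := rows_rcons s x; have [j' Ej'] := rows_rcons (rcons s x) y.
move: Eij; rewrite Ej' Ei' => /rcons_inj[/rcons_inj[ei] ej]; subst i' j'.
set l := hook_rows _ [:: c]; have El : l = [:: if c then 1 + count id e else 0].
  by rewrite /l /=; case: (c).
rewrite El cats1 -rcons_cons -Ei' => /rcons_inj[E ej].
rewrite descents_rcons -(IHs e us' E) -ltij ej cats1; congr rcons.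
case: c {l El} ej => // ej; symmetry.
have /allP al := hook_rows_lt e (ltn0Sn 0).
have : i \in rows (rcons s x) by rewrite Ei' mem_rcons mem_head.
by rewrite E inE => /orP[/eqP->//|/al].
Qed.

Lemma word_shape_hook s e : rows s = 0 :: hook_rows 1 e ->
  count id e = count negb e -> word_shape s = hook_fun (count id e).
Proof.
move=> E eqc; apply: functional_extensionality => i; rewrite /word_shape E.
rewrite content_cons /incr content_hook_rows // /hook_fun -eqc.
by case: (i =P 0); lia.
Qed.

Lemma conj_hook_fun m : conj_shape (hook_fun m) (hook_fun m).
Proof. by move=> i j; rewrite /hook_fun; case: (i =P 0); case: (j =P 0); lia. Qed.

(* Two transposed cells added to a symmetric hook never reach the diagonal, as a
   shape extended by a domino at the diagonal is not symmetric. *)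
Lemma hook_fun_extend m a b p q : is_part (incr (hook_fun m) a) ->
    conj_shape (incr (hook_fun m) a) (incr (hook_fun m) b) ->
    square_rule domino (hook_fun m) a b p q ->
    (let k := incr (incr (hook_fun m) a) q in conj_shape k k) ->
  incr (incr (hook_fun m) a) q = hook_fun m.+1.
Proof.
move=> pa cab R ck; have pm : is_part (hook_fun m).
  by move=> i j; rewrite /hook_fun; case: (i =P 0); case: (j =P 0); lia.
have [_ c] := conj_shape_incr pm pa (@conj_hook_fun m).
have Eb : b = hook_fun m a by apply: incr_inj (conj_shape_inj cab c).
have ltpa := is_part_incr_lt pa; move: R; rewrite /square_rule.
case: (eqVneq a b) => [eqab [-> D]|neqab [_ Eq]].
  (* The added cell is its own transpose, hence lies on the diagonal, in row and column 1; the cells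
     (1,2) and (2,1) then witness the asymmetry. *)
  rewrite -eqab in Eb; have [a1 m0] : a = 1 /\ 0 < m.
    by move: Eb; rewrite /hook_fun; case: (a =P 0); lia.
  exfalso; have := ck 1 2; rewrite a1.
  by case: D => [|[]]; rewrite a1 /incr /hook_fun => -> /=; lia.
subst q.
apply: functional_extensionality => i; rewrite Eb.
case: a pa cab c Eb ltpa neqab ck => [|a] pa cab c Eb ltpa neqab ck.
  by rewrite /incr /hook_fun /=; case: (i =P 0); lia.
have := ltpa a; have := ltpa 0; move: neqab; rewrite Eb /incr /hook_fun /=.
by case: (i =P 0); case: (a =P 0); lia.
Qed.

(** * Words sharing their recording tableau with their reverse *)

(** Deleting both ends keeps the hypothesis, so induction gives a symmetric hook for [v]. The words
    [x v] and [y (rev v)] have equal indices, and the latter is the reverse of [v y]; so the cells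
    added by [x] and by [y] are transposed. *)
Lemma self_reverse_hook s : uniq s -> s != [::] -> rows s = rows (rev s) ->
  exists m, word_shape s = hook_fun m.
Proof.
have [n] := ubnP (size s); elim: n s => // n IHn [|x s] // lts us _ eqr.
case/lastP: s => [|v y] in lts us eqr *.
  exists 0; rewrite -[[:: x]]/(rcons [::] x) word_shape_rcons_max //.
  apply: functional_extensionality => i.
  by rewrite /incr /hook_fun /word_shape /content /=; case: (i =P 0); lia.
have revE : rev (x :: rcons v y) = y :: rcons (rev v) x by rewrite rev_cons rev_rcons.
have ur : uniq (y :: rcons (rev v) x) by rewrite -revE rev_uniq.
have eqr' : rows (rcons (x :: v) y) = rows (rcons (y :: rev v) x) by rewrite rcons_cons eqr revE.
have eqv : rows v = rows (rev v).
  apply: (@rows_cat_inj v (rev v) [:: y] [:: x]); rewrite ?size_rev // !cats1.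
  by apply: (rows_behead us ur _ eqr'); rewrite !size_rcons size_rev.
have eqxv : rows (x :: v) = rows (y :: rev v).
  apply: (@rows_cat_inj _ _ [:: y] [:: x]); first by rewrite /= size_rev.
  by rewrite !cats1.
have uvy : uniq (rcons v y) by case/andP: us.
have uv : uniq v by move: uvy; rewrite rcons_uniq => /andP[].
have uxv : uniq (x :: v) by apply: subseq_uniq us; rewrite /= eqxx subseq_rcons.
have cab : conj_shape (word_shape (x :: v)) (word_shape (rcons v y)).
  rewrite {1}/word_shape eqxv -rev_rcons.
  by apply: conj_shape_sym; apply: conj_word_shape_rev.
have ck : conj_shape (word_shape (x :: rcons v y)) (word_shape (x :: rcons v y)).
  by have := conj_word_shape_rev us; rewrite /word_shape -eqr.
have [a [b [a' [b' [Ea Eb Ek _ R]]]]] := first_last us.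
have px := is_part_word_shape uxv; rewrite Ek Ea in ck *; rewrite Ea Eb in cab; rewrite Ea in px.
clear eqr eqr' revE ur eqxv uxv Ek.
(* For a word of length two the shape is a single domino, which is not symmetric. *)
case: v => [|z v] in lts us eqv uvy uv Ea Eb R px cab ck *.
  exfalso; have a0 : a = 0.
    by case: (a) px => // c px; have := is_part_incr_lt px (ltn0Sn c).
  have b0 : b = 0.
    have := is_part_word_shape uvy; rewrite Eb; case: (b) => // c pb.
    by have := is_part_incr_lt pb (ltn0Sn c).
  have := ck 0 1; move: R; rewrite a0 b0 => -[<-].
  by case=> [|[]] -> /=; rewrite /incr.
have [|m Em] := IHn (z :: v) _ uv isT eqv.
  by move: lts; rewrite /= !size_rcons; lia.
rewrite Em in px cab ck R *; exists m.+1; exact: hook_fun_extend R ck.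
Qed.

Lemma rev_negb_count e : rev e = map negb e -> count id e = count negb e.
Proof. by move=> E; rewrite -count_rev E count_map; apply: eq_count. Qed.

(** Once both words are known to be hooks, their bits are their descents, and reversal reverses and
    complements descents. *)
Theorem rows_rev_eq s : uniq s -> s != [::] ->
  rows s = rows (rev s) <->
  exists2 e, rows s = 0 :: hook_rows 1 e & rev e = map negb e.
Proof.
move=> us nz; split=> [eqr|[e E rE]].
  have [m Em] := self_reverse_hook us nz eqr.
  have [|e E] := @rows_hook s nz.
    by move=> i i0; rewrite Em /hook_fun; case: eqP; lia.
  exists e => //; have Ed := rows_hook_descents us E.
  have Er : e = descents (rev s) by apply: rows_hook_descents; rewrite ?rev_uniq -?eqr.
  by rewrite {1}Er descents_rev // -Ed revK.
(* Equally many bits of each kind make the hook symmetric, so the reverse, having the transposed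
   shape, is the same hook. *)
have ce := rev_negb_count rE; have Es := word_shape_hook E ce.
have Er : word_shape (rev s) = hook_fun (count id e).
  apply: conj_shape_inj (@conj_hook_fun _); rewrite -Es.
  exact: conj_word_shape_rev.
have [||e' E'] := @rows_hook (rev s).
- by rewrite -size_eq0 size_rev size_eq0.
- by move=> i i0; rewrite Er /hook_fun; case: eqP; lia.
rewrite E E'; congr (0 :: hook_rows 1 _).
rewrite (rows_hook_descents _ E') ?rev_uniq // descents_rev //.
by rewrite -(rows_hook_descents us E) -rE revK.
Qed.

(** * The recording tableau in terms of row indices *)

Definition rec_tab (rho : seq nat) : tableau :=
  foldl (fun t ki => add_cell t ki.2 ki.1) [::] (zip (iota 1 (size rho)) rho).

Lemma RS_rec_tab s : (RS s).2 = rec_tab (rows s).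
Proof.
rewrite /RS /rec_tab size_rows /rows.
suff gen T Q k : (foldl RS_step (T, Q) (zip (iota k (size s)) s)).2 =
    foldl (fun t ki => add_cell t ki.2 ki.1) Q (zip (iota k (size s)) (rows_from T s)).
  exact: gen.
elim: s T Q k => //= x s IHs T Q k.
by rewrite [RS_step _ _]/RS_step /=; case: (tab_insert x T) => T' i /=; apply: IHs.
Qed.

Lemma rec_tab_rcons rho i :
  rec_tab (rcons rho i) = add_cell (rec_tab rho) i (size rho).+1.
Proof.
rewrite /rec_tab size_rcons -[(size rho).+1 in LHS]addn1 iotaD cats1 zip_rcons ?size_iota //.
by rewrite foldl_rcons.
Qed.

Lemma nth_add_cell t i k r :
  nth [::] (add_cell t i k) r = if r == i then rcons (nth [::] t i) k else nth [::] t r.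
Proof. by rewrite nth_set_nth. Qed.

Lemma mem_rec_tab rho r k :
  (k \in nth [::] (rec_tab rho) r) = (0 < k <= size rho) && (nth 0 rho k.-1 == r).
Proof.
elim/last_ind: rho => [|rho i IHr]; first by case: r; case: k.
rewrite rec_tab_rcons nth_add_cell size_rcons nth_rcons.
case: k IHr => [|k] IHr.
  by case: eqP => [<-|_]; rewrite ?mem_rcons ?inE IHr.
case: eqP => [<-|neqr]; rewrite ?mem_rcons ?inE IHr /= ?eqSS ltnS.
  by case: ltngtP => //= _; rewrite eqxx.
case: ltngtP => //= _; symmetry; apply/eqP => eqi; exact: neqr.
Qed.

Lemma rec_tab_inj rho rho' : size rho = size rho' ->
  rec_tab rho = rec_tab rho' -> rho = rho'.
Proof.
move=> eqs eqQ; apply: (@eq_from_nth _ 0) => // k ltk.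
have := mem_rec_tab rho (nth 0 rho k) k.+1.
by rewrite eqQ mem_rec_tab -eqs /= ltk eqxx /= => /eqP.
Qed.

Lemma size_row_rec_tab rho r : size (nth [::] (rec_tab rho) r) = content rho r.
Proof.
elim/last_ind: rho => [|rho i IHr]; first by rewrite nth_nil.
rewrite rec_tab_rcons nth_add_cell content_rcons /incr -IHr.
by case: eqP => // ->; rewrite size_rcons.
Qed.

Lemma size_rec_tab rho : size (rec_tab rho) = foldl (fun m i => maxn m i.+1) 0 rho.
Proof.
elim/last_ind: rho => // rho i IHr.
by rewrite rec_tab_rcons size_set_nth foldl_rcons IHr maxnC.
Qed.

Lemma ohead_rec_tab rho : ohead (nth [::] (rec_tab (0 :: rho)) 0) = Some 1.
Proof.
elim/last_ind: rho => // rho i IHr.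
rewrite -rcons_cons rec_tab_rcons nth_add_cell; case: eqP => // <-.
by case: (nth _ _ _) IHr.
Qed.

Lemma size_rec_tab_hook e : size (rec_tab (0 :: hook_rows 1 e)) = (count id e).+1.
Proof.
by rewrite size_rec_tab /= max0n foldl_hook_rows.
Qed.

(** Bit [k] belongs to the letter [k + 2]: letters start at 1, and the corner letter 1 has no
    bit. *)
Lemma first_row_hook e k : k < size e ->
  (k.+2 \in first_row (rec_tab (0 :: hook_rows 1 e))) = ~~ nth false e k.
Proof.
move=> ltk; rewrite /first_row -nth0 mem_rec_tab /= size_hook_rows !ltnS ltk /=.
rewrite -{2}(@hook_rows_mask 1 e) // (nth_map 0) ?size_hook_rows //.
by rewrite negbK.
Qed.

(** Each row below the first has at most one entry, which is therefore its head, while the head of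
    row 0 is the letter 1. *)
Lemma first_column_hook e k : k < size e ->
  (k.+2 \in first_column (rec_tab (0 :: hook_rows 1 e))) = nth false e k.
Proof.
move=> ltk; set rho := 0 :: hook_rows 1 e; set Q := rec_tab rho.
have szr : size rho = (size e).+1 by rewrite /= size_hook_rows.
have Ek : nth false e k = (nth 0 rho k.+1 != 0).
  by rewrite -{1}(@hook_rows_mask 1 e) // (nth_map 0) ?size_hook_rows.
have sz1 r : 0 < r -> size (nth [::] Q r) <= 1.
  move=> r0; rewrite size_row_rec_tab content_cons /incr content_hook_rows //.
  by case: eqP; lia.
rewrite Ek /first_column mem_pmap; apply/mapP/idP => [[row /(nthP [::]) [r ltr <-]]|nz].
  case: r ltr => [|r] _; first by rewrite ohead_rec_tab.
  case Er : (nth [::] Q r.+1) => [|y row'] //= [Ey]; subst y.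
  have : k.+2 \in nth [::] Q r.+1 by rewrite Er mem_head.
  by rewrite mem_rec_tab => /andP[_ /eqP Er1]; rewrite (Er1 : nth 0 (hook_rows 1 e) k = r.+1).
have kin : k.+2 \in nth [::] Q (nth 0 rho k.+1).
  by rewrite mem_rec_tab szr /= ltnS ltk eqxx.
exists (nth [::] Q (nth 0 rho k.+1)).
  by apply: mem_nth; rewrite ltnNge; apply/negP=> /(nth_default [::]) E; rewrite E in kin.
move: (sz1 (nth 0 rho k.+1)) kin; rewrite lt0n => /(_ nz).
by case: (nth [::] Q _) => [|y []] //=; rewrite inE => _ /eqP->.
Qed.

(** * The tableau conditions in terms of bits *)

Lemma bitseq_le_count (a b : bitseq) : size a = size b ->
    (forall k, k < size a -> nth false a k -> nth false b k) ->
  count id a = count id b -> a = b.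
Proof.
elim: a b => [|x a IHa] [|y b] //= [eqs] le eqc.
have lexy : x ==> y by apply/implyP/(le 0).
have le' k : k < size a -> nth false a k -> nth false b k by move=> ltk; apply: (le k.+1).
have lec : count id a <= count id b.
  elim: (a) (b) eqs le' {IHa eqc le} => [|z a' IHa] [|t b'] //= [eqs] le'.
  apply: leq_add; first by move: (le' 0 isT); case: (z); case: (t) => //= /(_ isT).
  by apply: IHa => // k; apply: (le' k.+1).
have eqx : x = y by case: x y lexy eqc {le} => [] [] //= _; lia.
by rewrite eqx (IHa b) //; subst y; move/addnI: eqc.
Qed.

Lemma one_line_uniq_size n (w : 'S_n) :
  uniq (one_line w) /\ size (one_line w) = n.
Proof.
rewrite /one_line size_map size_enum_ord map_inj_uniq ?enum_uniq //.
by move=> i j [] /val_inj /perm_inj.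
Qed.

Lemma shape_rec_tab_hook e : count id e = count negb e ->
  shape (rec_tab (0 :: hook_rows 1 e)) = (count id e).+1 :: nseq (count id e) 1.
Proof.
move=> ce; apply: (@eq_from_nth _ 0) => [|r]; rewrite size_map size_rec_tab_hook.
  by rewrite /= size_nseq.
move=> ltr; rewrite (nth_map [::]) ?size_rec_tab_hook // size_row_rec_tab.
rewrite content_cons /incr content_hook_rows //.
case: r ltr => [|r] ltr /=; first by rewrite -ce.
by rewrite nth_nseq -[r < count id e]ltnS ltr; lia.
Qed.

Lemma transpose_hook k l :
  transpose_shape (k :: nseq l 1) = [seq (j < k) + (j == 0) * l | j <- iota 0 k].
Proof.
apply/eq_map => j /=; rewrite count_nseq; congr (_ + _ * _).
by case: j.
Qed.

Theorem Qtab_rev_eq n (w : 'S_n) : 0 < n ->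
  Qtab w = Qtab (rev_perm w) <->
  exists2 e, rows (one_line w) = 0 :: hook_rows 1 e & rev e = map negb e.
Proof.
move=> n0; have [us sz] := one_line_uniq_size w.
rewrite -rows_rev_eq //; last by rewrite -size_eq0 sz -lt0n.
rewrite /Qtab one_line_rev_perm !RS_rec_tab; split=> [|-> //].
by apply: rec_tab_inj; rewrite !size_rows size_rev.
Qed.

(** Symmetry of the hook says that both bit values occur equally often, and condition (ii) says that
    the mirror image of a false bit is true. *)
Theorem hook_condition n (w : 'S_n) : 0 < n ->
  (exists2 e, rows (one_line w) = 0 :: hook_rows 1 e & rev e = map negb e) <->
  [/\ hook_shape (shape (Qtab w)) /\ symmetric_shape (shape (Qtab w)) &
      forall i : nat, 1 < i <= n ->
        i \in first_row (Qtab w) -> n - i + 2 \in first_column (Qtab w)].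
Proof.
move=> n0; have [us sz] := one_line_uniq_size w.
rewrite /Qtab RS_rec_tab; have szr := size_rows (one_line w).
split=> [[e E rE]|[[[k kb shE] sym] cond]].
  rewrite E /= size_hook_rows sz in szr.
  have ce := rev_negb_count rE; rewrite E shape_rec_tab_hook //.
  split.
    split.
      exists (count id e).+1; rewrite /= sumn_nseq mul1n; first lia.
      by congr (_ :: nseq _ _); lia.
    rewrite /symmetric_shape transpose_hook; apply: (@eq_from_nth _ 0) => [|j].
      by rewrite size_map size_iota /= size_nseq.
    rewrite size_map size_iota => ltj.
    rewrite (nth_map 0) ?size_iota // nth_iota // add0n.
    case: j ltj => [|j] ltj /=; first by rewrite mul1n.
    by rewrite nth_nseq -[j < count id e]ltnS ltj; lia.
  case=> [|[|k]] // /andP[_ lek]; have ltk : k < size e by lia.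
  rewrite first_row_hook //.
  have -> : n - k.+2 + 2 = (size e - k.+1).+2 by lia.
  rewrite first_column_hook; last lia.
  by rewrite -nth_rev // rE (nth_map false).
set rho := rows (one_line w) in szr shE sym cond *; set sh := shape _ in kb shE sym.
have shN r : content rho r = nth 0 sh r.
  rewrite -size_row_rec_tab; case: (ltnP r (size (rec_tab rho))) => ltr.
    by rewrite /sh (nth_map [::]).
  by rewrite !nth_default // size_map.
have [||e E] := @rows_hook (one_line w).
- by rewrite -size_eq0 sz -lt0n.
- case=> // i _; rewrite /word_shape -/rho shN shE /= nth_nseq.
  by case: ifP.
have szsh : size sh = (count id e).+1 by rewrite size_map /rho E size_rec_tab_hook.
(* The transpose has as many rows as the first row of [sh] has cells. *)
have szk : size sh = k by rewrite -sym size_map size_iota shE.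
have ck : k = (count negb e).+1.
  by have := shN 0; rewrite /rho E content_cons /incr content_hook_rows // shE /= => <-.
have ce : count negb e = count id e by lia.
have sze : n = (size e).+1 by rewrite -sz -szr /rho E /= size_hook_rows.
(* Condition (ii) gives only an implication between bits; the equal counts turn it into equality. *)
exists e => //; symmetry; apply: bitseq_le_count.
- by rewrite size_map size_rev.
- move=> j; rewrite size_map => ltj; rewrite (nth_map false) // nth_rev // => nej.
  have := cond j.+2; rewrite /rho E first_row_hook // nej.
  have -> : n - j.+2 + 2 = (size e - j.+1).+2 by lia.
  by rewrite first_column_hook; [apply; lia | lia].
by rewrite count_map count_rev -ce; apply: eq_count.
Qed.

(** * Counting words with a given hook recording tableau *)

Lemma hook_rows_inj m : 0 < m -> injective (hook_rows m).
Proof. by move=> m0 e e' /(congr1 (map (fun i => i != 0))); rewrite !hook_rows_mask. Qed.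

(** A maximal letter at the foot of the first column is bumped down by every cell opening a row, so
    it raises the row count by one and leaves the bits unchanged. *)
Lemma push_hook_rows m tau e : 0 < m -> lattice m tau ->
  push m tau = hook_rows m.+1 e <-> tau = hook_rows m e.
Proof.
elim: tau m e => [|i tau IHt] m e m0 /=.
  by move=> _; case: e => [|[]].
case/andP=> leim; case: (i =P m) => [->|neqi] lat.
  rewrite (maxn_idPr (leqnSn m)) in lat.
  case: e => [|[] e] //=; split=> // -[].
  - by move/(IHt _ e (ltn0Sn m) lat)=> ->.
  - by move/(IHt _ e (ltn0Sn m) lat)=> ->.
  - by move=> m00; rewrite m00 in m0.
rewrite (_ : maxn m i.+1 = m) in lat; last lia.
case: e => [|[] e] //=; split=> // -[]; try lia.
- by move=> -> /(IHt _ e m0 lat) ->.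
- by move=> -> /(IHt _ e m0 lat) ->.
Qed.

(** A maximal letter in row 0 either stays, when only new rows follow, or is bumped to row 1. For a
    hook to result, row 1 must then be new and the bump must come at once. *)
Lemma push0_hook_rows m tau e : 0 < m -> lattice m tau ->
  push 0 tau = hook_rows m e <->
  (all id e /\ tau = hook_rows m e) \/
  (exists e', [/\ m = 1, e = true :: e' & tau = 0 :: hook_rows 1 e']).
Proof.
elim: tau m e => [|i tau IHt] m e m0 /=.
  move=> _; split=> [|[[]|[e' []]]] //.
  by case: e => [|[]] // _; left.
case/andP=> leim; case: (i =P 0) => [->|neqi] lat.
  rewrite (_ : maxn m 1 = m) in lat; last lia.
  case: e => [|[] e] //=; split.
  - by [].
  - by case=> [[]|[e' []]].
  - case=> m1; subst m; move/(push_hook_rows e (ltn0Sn 0) lat) => ->.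
    by right; exists e.
  - case=> [[_ []]|[e' [m1 [->] [Et]]]]; first lia.
    by subst m; rewrite (push_hook_rows e' _ lat).2.
  - by [].
  - by case=> [[]|[e' []]].
case: e => [|[] e] /=.
- by split=> // -[[]|[e' []]].
- split=> [[im]|].
    subst i; rewrite (maxn_idPr (leqnSn m)) in lat.
    by case/(IHt _ e (ltn0Sn m) lat) => [[al ->]|[e' []]]; [left | lia].
  case=> [[al [im Et]]|[e' [_ _ []]]] //; subst i.
  rewrite (maxn_idPr (leqnSn m)) in lat.
  by congr cons; apply/(IHt _ e (ltn0Sn m) lat); left.
- by split=> [[]|[[]|[e' []]]].
Qed.

(* The two ways of removing the largest letter of a word whose recording tableau
   is a hook: it was followed only by letters opening new rows, or preceded only
   by letters of the first row. *)
Lemma rows_hook_max M s1 s2 e : all (fun z => z < M) (s1 ++ s2) -> s1 ++ s2 != [::] ->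
  rows (s1 ++ M :: s2) = 0 :: hook_rows 1 e <->
  (exists e1 e2, [/\ e = e1 ++ false :: e2, all id e2, size s1 = (size e1).+1 &
     rows (s1 ++ s2) = 0 :: hook_rows 1 (e1 ++ e2)]) \/
  (exists e1 e2, [/\ e = e1 ++ true :: e2, ~~ has id e1, size s1 = size e1 &
     rows (s1 ++ s2) = 0 :: hook_rows 1 (e1 ++ e2)]).
Proof.
move=> alM nz; have [tau [E szt ->]] := rows_cat_max alM; rewrite E.
case: s1 => [|x s1] in alM nz E *.
  case: s2 nz => // x s2 _ in szt E alM *.
  have [tau' [E' lat]] := rows_cons x s2; rewrite [LHS]E' in E.
  have Et : tau = 0 :: tau' := esym E; subst tau; rewrite /=.
  split=> [[]|[[e1 [e2 []]]|[[|c e1] [e2 []]]]] //.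
    case: e => [|[] e] //= [] /(push_hook_rows e (ltn0Sn 0) lat) ->.
    by right; exists [::], e.
  by move=> -> _ _ /= [Et]; rewrite (push_hook_rows e2 _ lat).2.
have [r1 [E1 _]] := rows_cons x s1.
have szr : size r1 = size s1 by have := size_rows (x :: s1); rewrite E1 => -[].
have := lattice_rows ((x :: s1) ++ s2); rewrite E E1 /= max0n => lat0.
have lat e1 : r1 = hook_rows 1 e1 -> lattice (1 + count id e1) tau.
  by move=> Er; have [_] := lattice_cat lat0; rewrite Er foldl_hook_rows.
split=> [[Ee]|[[e1 [e2 [-> al2 [sz1] [Er]]]]|[e1 [e2 [-> al1 sz1 [Er]]]]]]; last first.
- case/lastP: e1 sz1 al1 Er => // e1 b; rewrite size_rcons => -[sz1].
  rewrite has_rcons negb_or => /andP[/negPf-> al1]; rewrite cat_rcons hook_rows_cat.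
  move/eqP; rewrite eqseq_cat; last by rewrite szr size_hook_rows.
  have c0 : count id e1 = 0 by apply/eqP; rewrite -leqn0 leqNgt -has_count.
  case/andP=> /eqP Er1 /eqP; rewrite c0 addn0 => Et; subst tau.
  rewrite cat_rcons hook_rows_cat -Er1 c0 addn0 /=; congr (_ :: _ ++ _ :: _).
  have latt := lat _ Er1; rewrite c0 addn0 in latt.
  by apply/(push0_hook_rows (true :: e2) (ltn0Sn 0) latt); right; exists e2.
- move/eqP: Er; rewrite hook_rows_cat eqseq_cat; last by rewrite szr size_hook_rows.
  case/andP=> /eqP Er1 /eqP Et; rewrite hook_rows_cat -Er1 /=.
  congr (_ :: _ ++ _ :: _).
  by apply/(push0_hook_rows e2 (ltn0Sn _) (lat _ Er1)); left.
have sze : size r1 < size e.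
  by have := congr1 size Ee; rewrite size_hook_rows size_cat /=; lia.
move: Ee; rewrite -{1}(cat_take_drop (size r1) e) hook_rows_cat => /eqP.
rewrite eqseq_cat; last by rewrite size_hook_rows size_take sze.
(* The next bit is that of [M], which enters in row 0 and so gives [false]. *)
set e1 := take _ e; case/andP=> /eqP Er1.
case Ed : (drop (size r1) e) => [|[] e2] //= /eqP[] //.
have Ee : e = e1 ++ false :: e2 by rewrite -Ed cat_take_drop.
have sz1 : size e1 = size s1 by rewrite size_take sze.
case/(push0_hook_rows e2 (ltn0Sn _) (lat _ Er1)) => [[al2 Et]|[e' [c1 Ee2 Et]]].
  left; exists e1, e2; split=> //; first by rewrite sz1.
  by rewrite hook_rows_cat Er1 Et.
have c0 : count id e1 = 0 by lia.
(* The letter bumping [M] takes over its cell in row 0, so what disappears with [M] is the following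
   [true] bit. *)
right; exists (rcons e1 false), e'; split.
- by rewrite cat_rcons -Ee2.
- by rewrite has_rcons /= has_count c0.
- by rewrite size_rcons sz1.
by rewrite cat_rcons hook_rows_cat /= c0 addn0 Er1 Et.
Qed.

Definition insert_at (M i : nat) (s : seq nat) : seq nat := take i s ++ M :: drop i s.

Lemma insert_at_filter M i s : M \notin s -> filter (predC1 M) (insert_at M i s) = s.
Proof.
move=> nM; rewrite filter_cat /= eqxx -filter_cat cat_take_drop.
by apply/all_filterP/allP => z zs /=; apply: contraNneq nM => <-.
Qed.

Definition hook_word (n : nat) (e : bitseq) (s : seq nat) : Prop :=
  perm_eq s (iota 1 n.+1) /\ rows s = 0 :: hook_rows 1 e.

Lemma perm_iota_max n s1 s2 :
  perm_eq (s1 ++ n.+2 :: s2) (iota 1 n.+2) = perm_eq (s1 ++ s2) (iota 1 n.+1).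
Proof.
have -> : iota 1 n.+2 = rcons (iota 1 n.+1) n.+2 by rewrite -cats1 -[n.+2 in LHS]addn1 iotaD.
by rewrite perm_sym perm_rcons perm_sym perm_catC cat_cons perm_cons perm_catC.
Qed.

Lemma hook_word_below n e s : hook_word n e s -> all (fun z => z < n.+2) s.
Proof. by case=> ps _; apply/allP=> z; rewrite (perm_mem ps) mem_iota; lia. Qed.

Lemma last_false_split (e : bitseq) : false \in e ->
  exists e1 e2, e = e1 ++ false :: e2 /\ all id e2.
Proof.
elim: e => // b e IHe; case: (boolP (false \in e)) => [/IHe[e1 [e2 [-> al]]] _|nf].
  by exists (b :: e1), e2.
rewrite inE (negPf nf) orbF => /eqP <-; exists [::], e; split=> //.
by apply/allP=> -[] // fe; rewrite fe in nf.
Qed.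

Lemma first_true_split (e : bitseq) : true \in e ->
  exists e1 e2, e = e1 ++ true :: e2 /\ ~~ has id e1.
Proof.
elim: e => // -[] e IHe; first by exists [::], e.
by rewrite inE => /IHe[e1 [e2 [-> al]]]; exists (false :: e1), e2.
Qed.

Lemma last_false_uniq (e1 e2 e3 e4 : bitseq) : all id e2 -> all id e4 ->
  e1 ++ false :: e2 = e3 ++ false :: e4 -> e1 = e3 /\ e2 = e4.
Proof.
have nf e : all id e -> false \notin e by move/allP=> al; apply/negP=> /al.
move=> /nf nf2 /nf nf4; elim: e1 e3 => [|b e1 IHe] [|c e3] //=.
- by case.
- by case=> _ E; rewrite E mem_cat mem_head orbT in nf2.
- by case=> _ E; rewrite -E mem_cat mem_head orbT in nf4.
by case=> -> /IHe[-> ->].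
Qed.

Lemma first_true_uniq (e1 e2 e3 e4 : bitseq) : ~~ has id e1 -> ~~ has id e3 ->
  e1 ++ true :: e2 = e3 ++ true :: e4 -> e1 = e3 /\ e2 = e4.
Proof.
elim: e1 e3 => [|b e1 IHe] [|c e3] //=.
- by move=> _ _ [].
- by rewrite negb_or => _ /andP[nc _] [Ec]; rewrite -Ec in nc.
- by rewrite negb_or => /andP[nb _] _ [Eb]; rewrite Eb in nb.
by rewrite !negb_or => /andP[_ h1] /andP[_ h3] [-> /(IHe _ h1 h3)[-> ->]].
Qed.

(** Pascal's rule: removing the largest letter deletes the last [false] or the first [true] bit of
    [e], and reinserting it at the prescribed position inverts this. *)
Lemma hook_words_list n e : size e = n ->
  exists L : seq (seq nat), [/\ uniq L, size L = 'C(n, count id e) &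
    forall s, s \in L <-> hook_word n e s].
Proof.
elim: n e => [|n IHn] e sze.
  rewrite (size0nil sze); exists [:: [:: 1]]; split=> // s; rewrite inE /hook_word.
  split=> [/eqP->//|[ps _]]; apply/eqP.
  by apply: perm_small_eq ps.
have bigL i (e' : bitseq) : size e' = n -> exists L : seq (seq nat),
    [/\ uniq L, size L = 'C(n, count id e') &
    forall s, s \in L <-> exists2 t, hook_word n e' t & s = insert_at n.+2 i t].
  move=> sze'; have [L [uL szL memL]] := IHn e' sze'.
  exists (map (insert_at n.+2 i) L); split; last first.
  - move=> s; split=> [/mapP[t /memL ht ->]|[t /memL tL ->]]; first by exists t.
    exact: map_f.
  - by rewrite size_map.
  rewrite map_inj_in_uniq // => t t' /memL/hook_word_below al /memL/hook_word_below al' E.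
  have nM w : all (fun z => z < n.+2) w -> n.+2 \notin w.
    by move/allP=> alw; apply/negP=> /alw; rewrite ltnn.
  by rewrite -(insert_at_filter i (nM _ al)) E insert_at_filter // nM.
pose spec1 s := exists e1 e2 t, [/\ e = e1 ++ false :: e2, all id e2,
  hook_word n (e1 ++ e2) t & s = insert_at n.+2 (size e1).+1 t].
pose spec2 s := exists e1 e2 t, [/\ e = e1 ++ true :: e2, ~~ has id e1,
  hook_word n (e1 ++ e2) t & s = insert_at n.+2 (size e1) t].
have [L1 [u1 sz1 mem1]] : exists L : seq (seq nat),
    [/\ uniq L, size L = 'C(n, count id e) & forall s, s \in L <-> spec1 s].
  case: (boolP (false \in e)) => [fe|nfe].
    have [e1 [e2 [Ee al2]]] := last_false_split fe.
    have [|L [uL szL memL]] := bigL (size e1).+1 (e1 ++ e2).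
      by move: sze; rewrite Ee !size_cat /= addnS => -[].
    exists L; split=> //; first by rewrite szL Ee !count_cat.
    move=> s; rewrite memL; split=> [[t ht Es]|[e3 [e4 [t [Ee' al4 ht Es]]]]].
      by exists e1, e2, t.
    by have [<- <-] := last_false_uniq al4 al2 (etrans (esym Ee') Ee); exists t.
  (* Without a [false] bit, [e] has [n + 1] true bits and the binomial coefficient vanishes. *)
  exists [::]; split=> //.
    have /eqP-> : count id e == size e.
      by rewrite -all_count; apply/allP=> -[] // fe; rewrite fe in nfe.
    by rewrite sze bin_small.
  move=> s; split=> // -[e1 [e2 [t [Ee _ _ _]]]].
  by rewrite Ee mem_cat mem_head orbT in nfe.
have [L2 [u2 sz2 mem2]] : exists L : seq (seq nat),
    [/\ uniq L, size L = (if count id e is c.+1 then 'C(n, c) else 0) &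
     forall s, s \in L <-> spec2 s].
  case: (boolP (true \in e)) => [te|nte].
    have [e1 [e2 [Ee al1]]] := first_true_split te.
    have [|L [uL szL memL]] := bigL (size e1) (e1 ++ e2).
      by move: sze; rewrite Ee !size_cat /= addnS => -[].
    exists L; split=> //; first by rewrite szL Ee !count_cat /= addnCA.
    move=> s; rewrite memL; split=> [[t ht Es]|[e3 [e4 [t [Ee' al3 ht Es]]]]].
      by exists e1, e2, t.
    by have [<- <-] := first_true_uniq al3 al1 (etrans (esym Ee') Ee); exists t.
  exists [::]; split=> //.
    have /eqP-> // : count id e == 0.
    by rewrite -leqn0 leqNgt -has_count; apply: contra nte => /hasP[[]].
  move=> s; split=> // -[e1 [e2 [t [Ee _ _ _]]]].
  by rewrite Ee mem_cat mem_head orbT in nte.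
exists (L1 ++ L2); split.
(* A common element would yield, on removing the largest letter, one hook word with two different
   numbers of true bits. *)
- rewrite cat_uniq u1 u2 andbT; apply/hasPn => s /mem2 [e3 [e4 [t' [E34 _ ht' Es']]]].
  apply/negP=> /mem1 [e1 [e2 [t [E12 _ ht Es]]]].
  have nM e' w : hook_word n e' w -> n.+2 \notin w.
    by move/hook_word_below/allP=> alw; apply/negP=> /alw; rewrite ltnn.
  have Et : t = t'.
    rewrite -(insert_at_filter (size e1).+1 (nM _ _ ht)) -Es Es'.
    exact: insert_at_filter (nM _ _ ht').
  subst t'; case: ht ht' => _ Er [_ Er'].
  move: Er'; rewrite Er => -[/(hook_rows_inj (ltn0Sn 0)) Ee].
  have := congr1 (count id) (etrans (esym E12) E34); have := congr1 (count id) Ee.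
  by rewrite !count_cat /=; lia.
- by rewrite size_cat sz1 sz2; case: (count id e) => [|c]; rewrite ?addn0 ?bin0 // binS.
have back i t e' : hook_word n e' t -> i <= n.+1 ->
    [/\ size (take i t) = i, all (fun z => z < n.+2) (take i t ++ drop i t),
        take i t ++ drop i t != [::] & perm_eq (insert_at n.+2 i t) (iota 1 n.+2)].
  move=> ht lei; have [pt _] := ht; have szt := perm_size pt.
  rewrite size_iota in szt; rewrite cat_take_drop perm_iota_max cat_take_drop.
  split=> //; first by rewrite size_takel ?szt.
    exact: hook_word_below ht.
  by rewrite -size_eq0 szt.
move=> s; rewrite mem_cat; split=> [/orP[/mem1|/mem2] [e1 [e2 [t [Ee al ht ->]]]]|[ps Er]].
- have [|szt alt nzt pt] := back (size e1).+1 _ _ ht.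
    by move: sze; rewrite Ee size_cat /=; lia.
  split=> //; apply/(rows_hook_max e alt nzt); left; exists e1, e2.
  by rewrite cat_take_drop szt; split=> //; case: ht.
- have [|szt alt nzt pt] := back (size e1) _ _ ht.
    by move: sze; rewrite Ee size_cat /=; lia.
  split=> //; apply/(rows_hook_max e alt nzt); right; exists e1, e2.
  by rewrite cat_take_drop szt; split=> //; case: ht.
have Ms : n.+2 \in s by rewrite (perm_mem ps) mem_iota; lia.
case/splitPr: Ms ps Er => s1 s2; rewrite perm_iota_max => ps Er.
have alM : all (fun z => z < n.+2) (s1 ++ s2).
  by apply/allP=> z; rewrite (perm_mem ps) mem_iota; lia.
have nz : s1 ++ s2 != [::] by rewrite -size_eq0 (perm_size ps) size_iota.
have insE : s1 ++ n.+2 :: s2 = insert_at n.+2 (size s1) (s1 ++ s2).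
  by rewrite /insert_at take_size_cat // drop_size_cat.
case/(rows_hook_max e alM nz): Er => -[e1 [e2 [Ee al szs Er]]]; apply/orP.
  by left; apply/mem1; exists e1, e2, (s1 ++ s2); rewrite -szs.
by right; apply/mem2; exists e1, e2, (s1 ++ s2); rewrite -szs.
Qed.

(** * From words to permutations *)

Lemma one_line_inj n : injective (@one_line n).
Proof.
move=> w w' E; apply/permP => i; apply: val_inj.
have /eq_in_map/(_ i) := E; rewrite mem_enum => /(_ isT).
by case.
Qed.

Lemma perm_one_line n (w : 'S_n) : perm_eq (one_line w) (iota 1 n).
Proof.
have [us sz] := one_line_uniq_size w.
rewrite uniq_perm ?iota_uniq //; have [] // := @uniq_min_size _ _ (iota 1 n) us.
  by move=> _ /mapP[i _ ->]; rewrite mem_iota; have := ltn_ord (w i); lia.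
by rewrite size_iota sz.
Qed.

Lemma one_line_surj n s : perm_eq s (iota 1 n.+1) -> exists w : 'S_n.+1, one_line w = s.
Proof.
move=> ps; have szs : size s = n.+1 by rewrite (perm_size ps) size_iota.
have us : uniq s by rewrite (perm_uniq ps) iota_uniq.
have bs i : i < n.+1 -> 0 < nth 0 s i <= n.+1.
  move=> lti; have : nth 0 s i \in iota 1 n.+1.
    by rewrite -(perm_mem ps) mem_nth ?szs.
  by rewrite mem_iota; lia.
pose f (i : 'I_n.+1) : 'I_n.+1 := inord (nth 0 s i).-1.
have fE i : (f i).+1 = nth 0 s i by rewrite inordK; have := bs i (ltn_ord i); lia.
have fI : injective f.
  move=> i j /(congr1 (fun k : 'I_n.+1 => k.+1)); rewrite !fE => /eqP.
  by rewrite nth_uniq ?szs // => /eqP/val_inj.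
exists (perm fI); apply: (@eq_from_nth _ 0); rewrite size_map size_enum_ord //.
move=> i lti; rewrite (nth_map ord0) ?size_enum_ord // permE fE.
by rewrite nth_enum_ord.
Qed.

Lemma card_hook_words n e : size e = n ->
  #|[set w : 'S_n.+1 | rows (one_line w) == 0 :: hook_rows 1 e]| = 'C(n, count id e).
Proof.
move=> sze; have [L [uL <- memL]] := hook_words_list sze.
rewrite cardE -(size_map (@one_line n.+1)); apply/perm_size/uniq_perm => //.
  by rewrite map_inj_uniq ?enum_uniq //; apply: one_line_inj.
move=> s; apply/mapP/idP => [[w]|/memL [ps Er]].
  by rewrite mem_enum inE => /eqP Er ->; apply/memL; split=> //; apply: perm_one_line.
by have [w Ew] := one_line_surj ps; exists w => //; rewrite mem_enum inE Ew Er.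
Qed.

(** The first half is free and fixes the second, which accounts for the power of 2 in the
    enumeration. *)
Lemma rev_negb_half m (e : bitseq) : size e = m.*2 ->
  rev e = map negb e <-> e = take m e ++ rev (map negb (take m e)).
Proof.
move=> sze; split=> [rE|].
  rewrite -{1}(cat_take_drop m e); congr (_ ++ _).
  rewrite map_take -rE take_rev revK sze; congr drop; lia.
move: (take m e) => d ->; rewrite rev_cat revK map_cat map_rev -map_comp.
congr (_ ++ rev _); rewrite -[LHS]map_id.
by apply: eq_map => b; rewrite /= negbK.
Qed.

(** In even size the number of bits is odd, so they cannot be balanced. In odd size the permutations
    are sorted by the first half of their bits, and each class consists of the words of one hook
    tableau. *)
Lemma card_Qtab_rev n : 0 < n ->
  #|[set w : 'S_n | Qtab w == Qtab (rev_perm w)]| =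
    (if odd n then 2 ^ ((n - 1) %/ 2) * 'C(n - 1, (n - 1) %/ 2) else 0).
Proof.
case: n => // n _; rewrite subn1 /=.
have AE (w : 'S_n.+1) : Qtab w = Qtab (rev_perm w) -> exists e,
    [/\ rows (one_line w) = 0 :: hook_rows 1 e, rev e = map negb e & size e = n].
  case/(Qtab_rev_eq w (ltn0Sn n)) => e E rE; exists e; split=> //.
  have := size_rows (one_line w); rewrite E /= size_hook_rows (one_line_uniq_size w).2.
  by case.
case: ifPn => [even_n|]; last first.
  rewrite negbK => odd_n; apply/eqP; rewrite cards_eq0; apply/eqP/setP => w.
  rewrite !inE; apply/negP => /eqP /AE [e [_ /rev_negb_count ce sze]].
  by move: odd_n; rewrite -sze -(count_predC id e) ce addnn odd_double.
set m := n %/ 2; have nE : n = m.*2 by rewrite /m; lia.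
(* Defined for every permutation; on hook words the map recovers the bits by [hook_rows_mask]. *)
pose half (w : 'S_n.+1) : m.-tuple bool :=
  [tuple nth false (map (fun i => i != 0) (behead (rows (one_line w)))) i | i < m].
rewrite -sum1_card (partition_big half xpredT) //=.
rewrite (eq_bigr (fun=> 'C(n, m))) => [|d _].
  by rewrite sum_nat_const card_tuple card_bool.
set e := d ++ rev (map negb d).
have sze : size e = n by rewrite size_cat size_rev size_map size_tuple addnn.
have te : take m e = d by rewrite take_size_cat ?size_tuple.
have ce : count id e = m.
  by rewrite count_cat count_rev count_map -[RHS](size_tuple d) -(count_predC id d).
rewrite -[in RHS]ce -(card_hook_words sze) -sum1_card; apply: eq_bigl => w.
rewrite !inE; apply/andP/eqP => [[/eqP /AE [e' [E rE sze']] /eqP Ed]|E].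
  have te' : take m e' = d.
    rewrite -Ed; apply: (@eq_from_nth _ false).
      by rewrite size_takel ?size_tuple // sze'; lia.
    move=> i; rewrite size_takel; last by rewrite sze'; lia.
    move=> lti; rewrite nth_take // -[RHS]/(nth false (tval (half w)) (Ordinal lti)).
    by rewrite -tnth_nth tnth_mktuple E /= hook_rows_mask.
  rewrite E; congr (0 :: hook_rows 1 _).
  have sz2 : size e' = m.*2 by rewrite sze'.
  by rewrite [LHS](proj1 (rev_negb_half sz2) rE) te'.
split.
  apply/eqP/Qtab_rev_eq => //; exists e => //.
  by apply/(rev_negb_half (m := m)); rewrite ?te // sze.
apply/eqP/eq_from_tnth => i.
rewrite tnth_mktuple E /= hook_rows_mask // (tnth_nth false) /=.
by rewrite nth_cat size_tuple ltn_ord.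
Qed.

Theorem theorem1p2 (n : nat) (hn : 1 <= n) :
  (forall w : 'S_n,
     Qtab w = Qtab (rev_perm w) <->
     [/\ hook_shape (shape (Qtab w)) /\ symmetric_shape (shape (Qtab w)) &
         forall i : nat, 1 < i <= n ->
           i \in first_row (Qtab w) -> n - i + 2 \in first_column (Qtab w)])
  /\
  #|[set w : 'S_n | Qtab w == Qtab (rev_perm w)]| =
    (if odd n then 2 ^ ((n - 1) %/ 2) * 'C(n - 1, (n - 1) %/ 2) else 0).
Proof.
split; last exact: card_Qtab_rev.
by move=> w; rewrite Qtab_rev_eq // hook_condition.
Qed.
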